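(* For the class of digraphs with $n$ nodes and independence number at most $\alpha$, any $p$-pass streaming algorithm for finding a Hamiltonian path, or for finding a Hamiltonian cycle, requires $\Omega\!\left(\frac{\alpha n}{p\log^2\alpha}\right)$ space.
   Context: All digraphs are simple; the independence number of a digraph is that of its underlying undirected graph. The problems are: output a directed Hamiltonian path (resp. directed Hamiltonian cycle) of the input digraph if one exists. Graph streaming model: arcs arrive in adversarial order and the algorithm makes $p$ forward passes over the stream. Space lower bounds are measured in bits. *)

(* Defs.v *)
From HB Require Import structures.
From mathcomp Require Import all_boot all_order all_algebra.
From mathcomp Require Import all_classical all_reals all_analysis.

Set Implicit Arguments.
Unset Strict Implicit.
Unset Printing Implicit Defensive.

Import Order.TTheory GRing.Theory Num.Theory.
Local Open Scope ring_scope.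

(* Simple means: no loops and no repeated arcs. The two arcs (x, y) and (y, x)
   are different arcs and may both be present. *)
Record digraph (n : nat) := Digraph {
  arcs : {set 'I_n * 'I_n};
  arcs_loopless : forall x : 'I_n, (x, x) \notin arcs }.

Definition arc n (G : digraph n) : rel 'I_n := fun x y => (x, y) \in arcs G.

Definition adjacent n (G : digraph n) : rel 'I_n :=
  fun x y => arc G x y || arc G y x.

Definition independent n (G : digraph n) (I : {set 'I_n}) : bool :=
  [forall x in I, forall y in I, ~~ adjacent G x y].

Definition independence_number n (G : digraph n) : nat :=
  \max_(I : {set 'I_n} | independent G I) #|I|.

(* A Hamiltonian path or cycle is given by the sequence of its n vertices. *)
Definition ham_path n (G : digraph n) (t : seq 'I_n) : bool :=
  [&& uniq t, size t == n & sorted (arc G) t].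

Definition ham_cycle n (G : digraph n) (t : seq 'I_n) : bool :=
  [&& uniq t, size t == n & cycle (arc G) t].

(* A deterministic streaming algorithm on n vertices whose working memory
   consists of s bits. On each arc it reads, and at the end of each pass, it
   updates its memory and appends a (possibly empty) sequence of vertices to a
   write-only output tape, which is not charged to the space; after the last
   pass it may append a sequence that depends on the final memory. Nothing but
   the memory survives from one arc, or one pass, to the next. *)
Record streaming_alg (n s : nat) := StreamingAlg {
  alg_init : s.-tuple bool;
  alg_step : s.-tuple bool -> 'I_n * 'I_n -> s.-tuple bool * seq 'I_n;
  alg_end_pass : s.-tuple bool -> s.-tuple bool * seq 'I_n;
  alg_final : s.-tuple bool -> seq 'I_n }.

(* Configurations pair the memory with the contents of the output tape. *)
Definition config (n s : nat) : Type := (s.-tuple bool * seq 'I_n)%type.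

Definition emit n s (f : s.-tuple bool -> s.-tuple bool * seq 'I_n)
    (c : config n s) : config n s :=
  ((f c.1).1, c.2 ++ (f c.1).2).

Definition run_pass n s (A : streaming_alg n s) (stream : seq ('I_n * 'I_n))
    (c : config n s) : config n s :=
  emit (alg_end_pass A)
    (foldl (fun c e => emit (fun m => alg_step A m e) c) c stream).

Definition output n s (A : streaming_alg n s) (p : nat)
    (stream : seq ('I_n * 'I_n)) : seq 'I_n :=
  let c := iter p (run_pass A stream) (alg_init A, [::]) in
  c.2 ++ alg_final A c.1.

(* A randomized algorithm is a finite probability distribution on deterministic
   ones; thus the random string may be reread at will and is not charged to the
   space. Deterministic algorithms are those with a one-point seed. *)
Record rand_streaming_alg (R : realType) (n s : nat) := RandStreamingAlg {
  seed : finType;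
  seed_prob : seed -> R;
  seed_prob_ge0 : forall w, 0 <= seed_prob w;
  seed_prob_sum1 : \sum_w seed_prob w = 1;
  alg_of_seed : seed -> streaming_alg n s }.

Definition arrival_order n (G : digraph n) (stream : seq ('I_n * 'I_n)) : bool :=
  perm_eq stream (enum (arcs G)).

(* The p-pass algorithm A outputs a solution of the search problem [sol],
   whenever there is one, on every digraph of independence number at most alpha
   and for every arrival order, with probability at least 2/3. The output on
   digraphs without solution is unconstrained. *)
Definition solves (R : realType) (n s : nat) (A : rand_streaming_alg R n s)
    (p alpha : nat) (sol : digraph n -> seq 'I_n -> bool) : Prop :=
  forall G : digraph n, (independence_number G <= alpha)%N ->
  (exists t : seq 'I_n, sol G t) ->
  forall stream : seq ('I_n * 'I_n), arrival_order G stream ->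
  2 / 3 <= \sum_(w : seed A | sol G (output (alg_of_seed w) p stream)) seed_prob w.

(* Main.v *)
(* The hard digraphs are chains of small gadgets: all arcs lead from earlier to
   later blocks, so a Hamiltonian path traverses the blocks one after the other.
   In a block of O(k) vertices Alice and Bob each hold a k x k bit matrix,
   encoded by "jump" arcs over a bidirected line. Its Hamiltonian paths climb the
   line to i, jump to w, descend to i + 1, jump to w + 1 and climb to the end, and
   the two jumps are one entry held by both players. Finding a Hamiltonian path
   thus solves n / k independent instances of "find the common element of two
   subsets of a k^2-element set" with k of order alpha. For bounded alpha a
   4-vertex gadget of independence number 2 reveals the parity of two bits.

   A p-pass algorithm with s bits is a protocol with O(p s) bits of communication,
   except that the tape is written jointly and for free. One more bit of memory,
   the type of the last vertex written, makes one of the players responsible for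
   the answer of each block. For the parity gadget counting suffices: the partner
   of a player who answers most blocks is determined up to few bits. For the
   matrix gadget, a transcript that is typical for a random owner of every
   coordinate has small total bias (the level-one inequality), the cut-and-paste
   identity of protocols turns this into closeness, in Hellinger distance, of the
   transcripts for the common elements J and i, and no transcript can then tell
   them apart. *)
Require Import Defs.
From HB Require Import structures.
From mathcomp Require Import all_boot all_order all_algebra.
From mathcomp Require Import all_classical all_reals all_analysis.
From mathcomp Require Import zify ring lra.
Import Defs.

Set Implicit Arguments.
Unset Strict Implicit.
Unset Printing Implicit Defensive.

(** * Hamiltonian paths on a line with jumps *)

Section Claims.
Variables (T C : Type) (typ : pred T) (dec : T -> seq C).

(* A vertex is decisive, with answers [dec v], when it follows a vertex of type
   [typ]; [l] is the type of the vertex before the tape. *)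
Fixpoint claims (l : bool) (t : seq T) : seq C :=
  if t is v :: t' then (if l then dec v else [::]) ++ claims (typ v) t'
  else [::].

Lemma claims_cat l t1 t2 :
  claims l (t1 ++ t2) = claims l t1 ++ claims (last l (map typ t1)) t2.
Proof. by elim: t1 l => [|v t1 IH] l //=; rewrite IH catA. Qed.

End Claims.

Lemma claims_nil_dec (T : eqType) C typ (dec : T -> seq C) l t :
  {in t, forall v, nilp (dec v)} -> claims typ dec l t = [::].
Proof.
elim: t l => [|v t IH] l //= H; rewrite IH ?cats0; last first.
  by move=> w wt; apply: H; rewrite inE wt orbT.
have /nilP-> : nilp (dec v) by apply: H; rewrite mem_head.
by case: l.
Qed.

Lemma claims_nil_typ (T : eqType) C typ (dec : T -> seq C) t :
  {in t, forall v, ~~ typ v} -> claims typ dec false t = [::].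
Proof.
elim: t => [|v t IH] //= H.
have /negbTE-> : ~~ typ v by apply: H; rewrite mem_head.
by apply: IH => w wt; apply: H; rewrite inE wt orbT.
Qed.

(* [lia] on a context stripped of the facts about sequences, which slow it down. *)
Local Ltac lia_nat :=
  repeat match goal with
  | H : forall _, _ |- _ => clear H
  | H : context [iota _ _] |- _ => clear H
  | H : is_true (uniq _) |- _ => clear H
  | H : is_true (path _ _ _) |- _ => clear H
  | H : is_true (sorted _ _) |- _ => clear H
  | H : {in _, forall _, _} |- _ => clear H
  end; lia.

Section Line.
Variables (a q : nat) (jmp : rel nat).
Hypothesis jmp_bound : forall u v, jmp u v -> [/\ u.+1 < a, a <= v & v.+1 < q].

(** The arc from [a.-1] up to [a] is missing, so the lower part is left only by a jump. No arc
    enters 0, and none leads from [q.-1] to a vertex below [q], which fixes both ends of a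
    Hamiltonian path. *)
Definition line_arc : rel nat := fun u v =>
  [|| (v == u.+1) && (u.+1 != a), (u == v.+1) && (0 < v) && (u.+1 < q) | jmp u v].

Definition reversal i w :=
  iota 0 i.+1 ++ rev (iota i.+1 (w - i)) ++ iota w.+1 (q - w.+1).

(** No jump starts at [a] or above, and a descent moves by one vertex, so a path above [w] gets
    below it only through [w]. *)
Lemma path_above w h t : a <= w -> w < h -> path line_arc h t -> w \notin t ->
  {in t, forall v, w < v}.
Proof.
move=> aw; elim: t h => [|h2 t IH] h //= wh /andP[e pt].
rewrite inE negb_or => /andP[n1 n2].
have wh2 : w < h2.
  by case/or3P: e => [|| /jmp_bound[]]; lia.
by move=> v; rewrite inE => /predU1P[->//|]; apply: IH wh2 pt n2 v.
Qed.

(** A path that stays at [a] or above makes no jump and climbs one vertex at a time. *)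
Lemma path_below w h t : h < w -> a <= h -> path line_arc h t ->
  {in t, forall v, a <= v} -> w \notin t -> {in t, forall v, v < w}.
Proof.
elim: t h => [|h2 t IH] h //= wh ah /andP[e pt] H.
rewrite inE negb_or => /andP[n1 n2].
have ah2 : a <= h2 by apply: H; rewrite mem_head.
have wh2 : h2 < w.
  by case/or3P: e => [|| /jmp_bound[]]; lia.
move=> v; rewrite inE => /predU1P[->//|].
by apply: IH wh2 ah2 pt _ n2 v => v' vt; apply: H; rewrite inE vt orbT.
Qed.

Section Ham.
Variable s : seq nat.
Hypotheses (aq : a < q) (a0 : 0 < a).
Hypotheses (sP : perm_eq s (iota 0 q)) (sA : sorted line_arc s).

Let mem_s v : (v \in s) = (v < q).
Proof. by rewrite (perm_mem sP) mem_iota add0n. Qed.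

Let uniq_s : uniq s. Proof. by rewrite (perm_uniq sP) iota_uniq. Qed.

Lemma line_start : exists t, s = 0 :: t.
Proof.
have := mem_s 0; rewrite (ltn_trans a0 aq) => /splitPr E.
case: E sA => [[|x p] t]; first by exists t.
rewrite /= cat_path /= => /andP[_ /andP[e _]]; exfalso.
by case/or3P: e => [|| /jmp_bound[]]; lia_nat.
Qed.

(** A descent from the initial climb would return to a visited vertex, and the climb ends at [a.-1]
    at the latest; so the first arc that does not climb is a jump. *)
Lemma line_up : exists i w t, jmp i w /\ s = iota 0 i.+1 ++ w :: t.
Proof.
have [t0 E0] := line_start.
suff H : forall k i t, i < a -> a - i <= k -> s = iota 0 i.+1 ++ t ->
    exists i w t, jmp i w /\ s = iota 0 i.+1 ++ w :: t.
  by apply: (H a 0 t0) => //; rewrite subn0.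
elim=> [|k IH] i t ia ak E; first by lia_nat.
case: t E => [|w t] E.
  by have := mem_s q.-1; rewrite E cats0 mem_iota; lia_nat.
have : line_arc i w.
  have := sA; rewrite E -[i.+1]addn1 iotaD -catA /= add0n.
  case: (iota 0 i) => [|x p]; first by move=> /andP[].
  by rewrite /= cat_path /= => /and4P[].

case/or3P=> [/andP[/eqP wi ia'] | | J]; last by exists i, w, t.
- apply: (IH i.+1 t); [lia_nat | lia_nat |].
  by rewrite E wi -[i.+2]addn1 iotaD -catA /= add0n.
- move=> /andP[/andP[/eqP iw w0] _].
  have := uniq_s; rewrite E cat_uniq => /and3P[_ /hasPn/(_ w) + _].
  by rewrite mem_head mem_iota => /(_ isT); lia_nat.
Qed.

(* After the jump from [i] to [w] the rest of the lower part can only be entered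
   from [a], so the path descends to [i.+1]; a jump to [w.+1] must follow, since
   vertices skipped above [w] or below [i.+1] could not be reached any more. *)
Lemma line_ham : exists i w t2, [/\ jmp i w, jmp i.+1 w.+1,
  s = iota 0 i.+1 ++ rev (iota i.+1 (w - i)) ++ w.+1 :: t2
  & {in t2, forall v, w < v}].
Proof.
have [i [w [t [Jiw E]]]] := line_up.
have [ia aw wq] := jmp_bound Jiw.
suff H : forall k v t, v - i <= k -> i < v <= w ->
    s = iota 0 i.+1 ++ rev (iota v (w - v).+1) ++ t ->
    exists t2, [/\ jmp i.+1 w.+1, 
     s = iota 0 i.+1 ++ rev (iota i.+1 (w - i)) ++ w.+1 :: t2
  & {in t2, forall v, w < v}].
  have [t2 [? ? ?]] : exists t2, [/\ jmp i.+1 w.+1,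
      s = iota 0 i.+1 ++ rev (iota i.+1 (w - i)) ++ w.+1 :: t2
      & {in t2, forall v, w < v}].
    by apply: (H (w - i) w t); [lia_nat | lia_nat | rewrite subnn].
  by exists i, w, t2.
elim=> [|k IH] v t' vk vw E'; first by lia_nat.
have US := uniq_s.
case: t' E' => [|h t'] E'.
  have := mem_s q.-1; rewrite E' cats0 mem_cat mem_rev !mem_iota; lia_nat.
have [pvh pt'] : line_arc v h /\ path line_arc h t'.
  have := sA; rewrite E'.
  have -> : rev (iota v (w - v).+1) = rcons (rev (iota v.+1 (w - v))) v.
    by rewrite /= rev_cons.
  rewrite cat_rcons catA; case: (_ ++ rev _) => [|x p] /=; first by case/andP.
  by rewrite cat_path /= => /and3P[_ _ /andP[]].
have hN : (h \notin iota 0 i.+1) && (h \notin iota v (w - v).+1).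
  move: US; rewrite E' cat_uniq => /and3P[_ /hasPn/(_ h) + ].
  rewrite mem_cat mem_head orbT => ->//.
  rewrite cat_uniq => /and3P[_ /hasPn/(_ h)]; rewrite mem_head mem_rev.
  by move=> ->.
have tN u : u \in h :: t' -> ~~ (u <= i) && ~~ (v <= u <= w).
  move=> uht; move: US; rewrite E' cat_uniq => /and3P[_ /hasPn/(_ u) + ].
  rewrite mem_cat uht orbT mem_iota => /(_ isT) h1.
  rewrite cat_uniq => /and3P[_ /hasPn/(_ u)]; rewrite uht mem_rev mem_iota.
  by move=> /(_ isT); lia_nat.
have tM u : u < q -> i < u -> ~~ (v <= u <= w) -> u \in h :: t'.
  by rewrite -mem_s E' !mem_cat mem_rev !mem_iota; case: (u \in _ :: _); lia_nat.
have hq : h < q by rewrite -mem_s E' !mem_cat mem_head !orbT.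
have := tN h (mem_head _ _) => hh.
have above : a <= w -> w < h -> {in h :: t', forall u, w < u}.
  move=> _ wh u; rewrite inE => /predU1P[->//|].
  apply: (path_above (h := h)) => //; apply/negP => wt.
  by have := tN w; rewrite inE wt orbT; lia_nat.
have uht : uniq (h :: t').
  by move: US; rewrite E' !cat_uniq => /and3P[_ _ /and3P[]].
case/or3P: pvh => [/andP[/eqP hv va]|/andP[/andP[/eqP vh h0] vq]|Jvh].
(* Climbing is possible only from [w], since the vertices from [v] to [w] are used up; it would
   leave [i.+1] behind for good. *)
- have vw' : v = w by lia_nat.
  have := above aw; rewrite {1}hv vw' => /(_ (ltnSn _)) ab.
  have : i.+1 \in h :: t' by apply: tM; lia_nat.
  by move/ab; lia_nat.
- apply: (IH h t'); [lia_nat|lia_nat|].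
  rewrite E'; congr (_ ++ _).
  have -> : (w - h).+1 = (w - v).+2 by lia_nat.
  by rewrite [in RHS]/= -vh [in RHS]rev_cons cat_rcons.
- have [va ah hq1] := jmp_bound Jvh.
  have wh : w < h by lia_nat.
  have ab := above aw wh.
  have vi : v = i.+1.
    apply/eqP/negPn/negP => ne.
    have : i.+1 \in h :: t' by apply: tM; lia_nat.
    by move/ab; lia_nat.
  (* For [h] above [w.+1], going up from [h] would lose [w.+1], and going down would lose [q.-1]. *)
  suff hw : h = w.+1.
    exists t'; split; first by rewrite -vi -hw.
    - by rewrite E' vi hw; have -> : (w - i.+1).+1 = w - i by lia_nat.
    - by move=> u ut; apply: ab; rewrite inE ut orbT.
  case: t' E' pt' uht tN tM ab above => [|h2 t'] E' pt' uht tN tM ab above.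
    have : q.-1 \in [:: h] by apply: tM; lia_nat.
    by rewrite inE; lia_nat.
  move: pt' => /=/andP[e pt'].
  have ht : h \notin t' by move: uht => /= /andP[]; rewrite inE negb_or => /andP[].
  have wh2 : w < h2 by apply: ab; rewrite !inE eqxx orbT.
  case/or3P: e => [/andP[/eqP hv _]|/andP[/andP[/eqP vh _] _]| /jmp_bound[]]; last by lia_nat.
  + have ab2 := path_above (w := h) ah _ pt' ht.
    have : w.+1 \in [:: h, h2 & t'] by apply: tM; lia_nat.
    rewrite !inE => /or3P[/eqP//|/eqP|/ab2]; lia_nat.
  + have : q.-1 \in [:: h, h2 & t'] by apply: tM; lia_nat.
    rewrite !inE => /or3P[/eqP|/eqP|]; try lia_nat.
    have bel : {in t', forall u, u < h}.
      apply: path_below pt' _ ht; try lia_nat.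
      by move=> u ut; have := ab u; rewrite !inE ut !orbT => /(_ isT); lia_nat.
    by move/bel; lia_nat.
Qed.
End Ham.

Lemma reversal_perm i w : i <= w < q -> perm_eq (reversal i w) (iota 0 q).
Proof.
move=> iw; rewrite /reversal.
apply: (@perm_trans _ (iota 0 i.+1 ++ iota i.+1 (w - i) ++ iota w.+1 (q - w.+1))).
  by rewrite perm_cat2l perm_cat2r perm_rev.
have -> : w.+1 = i.+1 + (w - i) by lia.
rewrite -iotaD.
have -> : iota 0 i.+1 ++ iota i.+1 (w - i + (q - (i.+1 + (w - i)))) = iota 0 q.
  by rewrite -{2}[i.+1]add0n -iotaD; congr iota; lia.
exact: perm_refl.
Qed.

Lemma reversal_sorted i w : jmp i w -> jmp i.+1 w.+1 ->
  sorted line_arc (reversal i w).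
Proof.
move=> J1 J2; have [ia aw wq] := jmp_bound J1; rewrite /reversal.
(* The side condition keeps the climb away from the missing arc into [a]. *)
have up : forall j n, j + n <= a \/ a <= j -> path line_arc j (iota j.+1 n.-1).
  move=> j n; elim: n j => [|[|n] IH] j H //=; rewrite IH ?andbT; last by lia.
  by rewrite /line_arc eqxx; apply/orP; left; lia.
have dn : forall n, n < w - i -> path line_arc w (rev (iota (w - n) n)).
  elim=> [|n IH] H //.
  have -> : rev (iota (w - n.+1) n.+1) = rcons (rev (iota (w - n) n)) (w - n.+1).
    rewrite /= rev_cons; congr (rcons (rev (iota _ _)) _); lia.
  rewrite rcons_path IH /=; last lia.
  have -> : last w (rev (iota (w - n) n)) = w - n.
    case: n {IH} H => [|n] H; first by rewrite subn0.
    by rewrite /= rev_cons last_rcons.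
  by rewrite /line_arc; apply/or3P/Or32; lia.
have -> : w - i = (w - i.+1).+1 by lia.
have [n En] : exists n, q - w.+1 = n.+1 by exists (q - w.+2); lia.
have -> : rev (iota i.+1 (w - i.+1).+1) = w :: rev (iota i.+1 (w - i.+1)).
  rewrite -[(w - i.+1).+1]addn1 iotaD rev_cat /=; congr (_ :: _); lia.
rewrite En /= !cat_path /=.
have -> : last 0 (iota 1 i) = i.
  by case: (i) => // j; rewrite -{1}[j.+1]addn1 iotaD last_cat.
have A1 : line_arc i w by rewrite /line_arc J1 !orbT.
have A2 : line_arc i.+1 w.+1 by rewrite /line_arc J2 !orbT.
rewrite A1 (up 0 i.+1); last by left; lia.
have := dn (w - i.+1); rewrite subKn; last lia.
rewrite cat_path /= => ->; last lia.
have -> : last w (rev (iota i.+1 (w - i.+1))) = i.+1.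
  case: (posnP (w - i.+1)) => [e|]; first by rewrite e /=; lia.
  by case: (w - i.+1) => // j _; rewrite /= rev_cons last_rcons.
by rewrite A2 (up w.+1 n.+1) //; right; lia.
Qed.

End Line.

(** * Two gadgets *)

(** [bp] marks the pairs whose arcs are Bob's. It does not depend on the inputs, so the end points
    of an arc tell who holds it. *)
Definition gadget (bp gA gB : rel nat) : rel nat :=
  fun u v => if bp u v then gB u v else gA u v.

Definition gadget_ham (g : rel nat) (q : nat) (s : seq nat) :=
  perm_eq s (iota 0 q) && sorted g s.

Section LineClaims.
Variables (C : Type) (a q : nat) (jmp : rel nat) (dec : nat -> seq C).
Hypothesis jmp_bound : forall u v, jmp u v -> [/\ u.+1 < a, a <= v & v.+1 < q].
Hypothesis decL : forall v, v < a -> dec v = [::].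
Hypothesis decS : forall u v, jmp u v -> dec v.+1 = [::].

(** Only [w] and [w.+1], the targets of the two jumps, are upper vertices that follow a lower one,
    and [w.+1] carries no answer. *)
Lemma line_claims l s : gadget_ham (line_arc a q jmp) q s -> a < q -> 0 < a ->
  exists i w, [/\ jmp i w, jmp i.+1 w.+1 &
    claims (fun v => v < a) dec l s = dec w].
Proof.
case/andP=> sP sS aq a0.
have [i [w [t [J1 J2 E t2]]]] := line_ham jmp_bound aq a0 sP sS.
exists i, w; split=> //; have [ia aw wq] := jmp_bound J1.
have Er : rev (iota i.+1 (w - i)) =
    w :: rev (iota a (w - a)) ++ rev (iota i.+1 (a - i.+1)).
  have -> : w - i = (a - i.+1) + (w - a).+1 by lia.
  rewrite iotaD rev_cat subnKC; last by lia.
  by rewrite -[(w - a).+1]addn1 iotaD rev_cat subnKC.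
rewrite Er in E.
rewrite E claims_cat claims_nil_dec; last first.
  by move=> v; rewrite mem_iota => vi; rewrite decL //; lia.
have -> : last l (map (fun v => v < a) (iota 0 i.+1)) = true.
  by rewrite -addn1 iotaD map_cat last_cat /=; lia.
rewrite /= ltnNge aw /= -[RHS]cats0; congr (_ ++ _).
rewrite -catA claims_cat claims_nil_typ; last first.
  by move=> v; rewrite mem_rev mem_iota; lia.
rewrite /= claims_cat claims_nil_dec; last first.
  by move=> v; rewrite mem_rev mem_iota => vi; rewrite decL //; lia.
rewrite /= (decS J1) if_same /=.
have -> : (w.+1 < a) = false by lia.
by apply: claims_nil_typ => v /t2; lia.
Qed.

End LineClaims.

Section MatrixGadget.
Variable k : nat.

(* The line gadget of size [9 k]: entry [(r, c, beta)] of the matrix is the jump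
   from [3 r] to [3 (k + 2 c + beta)] for Alice, and the same jump shifted by one
   for Bob. Residues modulo 3 tell Alice's jumps from Bob's. *)
Definition entry : finType := ('I_k * 'I_k * bool)%type.
Definition entry_row (e : entry) := 3 * e.1.1.
Definition entry_col (e : entry) := 3 * (k + (2 * e.1.2 + e.2)).

Definition jmpA (x : entry -> bool) : rel nat := fun u v =>
  [exists e, [&& x e, u == entry_row e & v == entry_col e]].
Definition jmpB (y : entry -> bool) : rel nat := fun u v =>
  [exists e, [&& y e, u == (entry_row e).+1 & v == (entry_col e).+1]].

Definition mat_bob : rel nat := fun u v => (u %% 3 == 1) && (v %% 3 == 1).
Definition mat_alice (x : entry -> bool) := line_arc (3 * k) (9 * k) (jmpA x).
Definition mat_typ v := v < 3 * k.
(** The target [3 (k + 2 c + beta)] of a jump of Alice yields [beta]; a target of Bob is 1 modulo 3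
    and yields nothing. *)
Definition mat_dec v :=
  if (3 * k <= v) && (v %% 3 == 0) then [:: odd (v %/ 3 - k)] else [::].

Definition mat_gadget x y := gadget mat_bob (mat_alice x) (jmpB y).

Lemma entry_bound (e : entry) :
  entry_row e + 2 < 3 * k /\ 3 * k <= entry_col e /\ entry_col e + 2 < 9 * k.
Proof.
case: e => [[[r hr] [c hc]] b]; rewrite /entry_row /entry_col /=.
by case: b => /=; lia.
Qed.

Lemma entry_inj (e e' : entry) :
  entry_row e = entry_row e' -> entry_col e = entry_col e' -> e = e'.
Proof.
case: e e' => [[r c] b] [[r' c'] b']; rewrite /entry_row /entry_col /= => h1 h2.
congr (_, _, _); try (apply: val_inj => /=); by case: b b' h2 => [] []; lia.
Qed.

(** A line arc joins different residues modulo 3 and a jump of Alice joins residues 0, so the pairs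
    of Bob carry only his jumps. *)
Lemma matE x y : mat_gadget x y =2
  line_arc (3 * k) (9 * k) (fun u v => jmpA x u v || jmpB y u v).
Proof.
move=> u v; rewrite /mat_gadget /gadget /mat_bob /mat_alice /line_arc.
case: ifP => [/andP[/eqP u1 /eqP v1]|uv].
  have -> : jmpA x u v = false.
    by apply/existsP => -[e /and3P[_ /eqP uE _]]; move: u1; rewrite uE /entry_row; lia.
  have -> : (v == u.+1) = false by lia.
  by have -> : (u == v.+1) = false by lia.
have -> : jmpB y u v = false.
  apply/existsP => -[e /and3P[_ /eqP uE /eqP vE]]; move: uv.
  by rewrite uE vE /entry_row /entry_col; lia.
by rewrite orbF.
Qed.

Lemma mat_jmp_bound x y u v : jmpA x u v || jmpB y u v ->
  [/\ u.+1 < 3 * k, 3 * k <= v & v.+1 < 9 * k].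
Proof.
by case/orP=> /existsP[e /and3P[_ /eqP-> /eqP->]]; have := entry_bound e; split; lia.
Qed.

(** The two jumps start at [i] and [i.+1]. Sources are 0 modulo 3 for Alice and 1 for Bob, so the
    first jump is hers, the second his, and both encode the same entry. *)
Lemma mat_claims (x y : entry -> bool) beta l s : 0 < k ->
  (forall e, x e -> y e -> e.2 = beta) ->
  gadget_ham (mat_gadget x y) (9 * k) s -> claims mat_typ mat_dec l s = [:: beta].
Proof.
move=> k0 H; rewrite /gadget_ham (eq_sorted (matE x y)) => sH.
have decL v : v < 3 * k -> mat_dec v = [::].
  by move=> va; rewrite /mat_dec; case: ifP => //; lia.
have decS u v : jmpA x u v || jmpB y u v -> mat_dec v.+1 = [::].
  by case/orP=> /existsP[e /and3P[_ _ /eqP->]]; rewrite /mat_dec /entry_col;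
    case: ifP => //; lia.
have [||i [w [J1 J2 ->]]] := line_claims (@mat_jmp_bound x y) decL decS l sH; try lia.
have rowS1 e e' : entry_row e = (entry_row e').+1 -> False by rewrite /entry_row; lia.
have rowS2 e e' : entry_row e = (entry_row e').+2 -> False by rewrite /entry_row; lia.
case/orP: J1 => /existsP[e /and3P[xe /eqP ie /eqP we]]; case/orP: J2 =>
  /existsP[e' /and3P[xe' /eqP ie' /eqP we']]; rewrite ?ie ?we in ie' we'.
- by move: (esym ie') => /rowS1.
- have ee : e = e' by apply: entry_inj; congruence.
  rewrite we -(H e) // ?[in y _]ee // /mat_dec /entry_col.
  have -> : 3 * k <= 3 * (k + (2 * e.1.2 + e.2)) by lia.
  have -> : (3 * (k + (2 * e.1.2 + e.2))) %% 3 == 0 by lia.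
  have -> : 3 * (k + (2 * e.1.2 + e.2)) %/ 3 - k = 2 * e.1.2 + e.2 by lia.
  by rewrite /= oddD oddM; case: (e.2).
- by move: (esym ie') => /rowS2.
- by case: ie' => /esym /rowS1.
Qed.

Lemma mat_exists (x y : entry -> bool) e : x e -> y e ->
  exists s, gadget_ham (mat_gadget x y) (9 * k) s.
Proof.
move=> xe ye; have [b1 [b2 b3]] := entry_bound e.
exists (reversal (9 * k) (entry_row e) (entry_col e)).
rewrite /gadget_ham (eq_sorted (matE x y)) reversal_perm; last by lia.
apply: reversal_sorted; first exact: mat_jmp_bound.
- by apply/orP; left; apply/existsP; exists e; rewrite xe !eqxx.
- by apply/orP; right; apply/existsP; exists e; rewrite ye !eqxx.
Qed.

Lemma mat_irr x y u : mat_gadget x y u u = false.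
Proof.
by apply/negP; rewrite matE => /or3P[| |/mat_jmp_bound[]]; lia.
Qed.

End MatrixGadget.

(* The path visits [x], [~~ x] in the pair {0, 1}, in the order given by Alice's
   arc, and then the pair {2, 3}, entered by Bob's arc. *)
Definition xor_bob : rel nat := fun u v => (u < 2) && (2 <= v).
Definition xor_alice (x : bool) : rel nat := fun u v =>
  [|| [&& u == x :> nat & v == ~~ x :> nat], (u == 2) && (v == 3) | (u == 3) && (v == 2)].
Definition xor_jmp (y : bool) : rel nat := fun u v =>
  (u < 2) && (v == 2 + ((u == 1) (+) y)).
Definition xor_gadget x y := gadget xor_bob (xor_alice x) (xor_jmp y).
Definition xor_typ v := v < 2.
Definition xor_dec v := if 2 <= v then [:: v == 2] else [::].

Lemma xor_claims x y l s : gadget_ham (xor_gadget x y) 4 s ->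
  claims xor_typ xor_dec l s = [:: x (+) y].
Proof.
case/andP; rewrite -mem_permutations => sP.
have : all (fun s => sorted (xor_gadget x y) s ==>
    (claims xor_typ xor_dec l s == [:: x (+) y]))
  (permutations (iota 0 4)) by case: x; case: y; case: l; vm_compute.
by move/allP/(_ s sP)/implyP=> H /H/eqP.
Qed.

Lemma xor_exists x y : exists s, gadget_ham (xor_gadget x y) 4 s.
Proof.
exists [:: nat_of_bool x; nat_of_bool (~~ x); 2 + (~~ x (+) y); 2 + (x (+) y)].
by case: x; case: y; vm_compute.
Qed.

Lemma xor_irr x y u : xor_gadget x y u u = false.
Proof.
by rewrite /xor_gadget /gadget /xor_bob /xor_alice /xor_jmp; case: ifP; case: x; lia.
Qed.

(** Each of the pairs {0, 1} and {2, 3} carries an arc. *)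
Lemma xor_independent x y s : uniq s -> all (gtn 4) s ->
  {in s &, forall u v, ~~ xor_gadget x y u v} -> size s <= 2.
Proof.
move=> us s4 H.
have E : perm_eq s (seq.filter (mem s) (iota 0 4)).
  apply: uniq_perm; rewrite ?filter_uniq ?iota_uniq // => v.
  rewrite mem_filter mem_iota /=; have [vs|] := boolP (v \in s); last by [].
  by have := allP s4 v vs.
rewrite (perm_size E) /=.
have h01 : ~~ ((0 \in s) && (1 \in s)).
  apply/negP => /andP[h0 h1]; have := H _ _ h0 h1; have := H _ _ h1 h0.
  by clear; case: x; case: y.
have h23 : ~~ ((2 \in s) && (3 \in s)).
  apply/negP => /andP[h0 h1]; have := H _ _ h0 h1; have := H _ _ h1 h0.
  by clear; case: x; case: y.
by case: (0 \in s) h01; case: (1 \in s) => //; case: (2 \in s) h23; case: (3 \in s).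
Qed.

(** * Chains of gadgets *)

Lemma sorted_cat_all (T : eqType) (e : rel T) s1 s2 :
  sorted e s1 -> sorted e s2 -> {in s1 & s2, forall u v, e u v} ->
  sorted e (s1 ++ s2).
Proof.
case: s1 => [|x p] //= H1 H2 H; rewrite cat_path H1 /=.
case: s2 H2 H => [|y r] //= H2 H; rewrite H2 andbT.
by apply: H; rewrite ?mem_last ?mem_head.
Qed.

Lemma sorted_key_split (T : Type) (k : T -> nat) b t :
  sorted (fun u v => k u <= k v) t ->
  t = [seq v <- t | k v < b] ++ [seq v <- t | k v == b] ++ [seq v <- t | b < k v].
Proof.
elim: t => [|u t IH] // H.
have leT : transitive (fun u v => k u <= k v).
  by move=> y x z; apply: leq_trans.
have Ha := order_path_min leT H.
have {}IH := IH (path_sorted H); rewrite /=.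
have filt0 (p : pred T) : (forall v, k u <= k v -> ~~ p v) -> [seq v <- t | p v] = [::].
  move=> H'; elim: (t) Ha => //= x s IHs /andP[/H'/negbTE-> /IHs->] //.
case: (ltngtP (k u) b) => ub /=.
- by rewrite [in LHS]IH.
- have F1 : [seq v <- t | k v < b] = [::] by apply: filt0 => v; lia.
  have F2 : [seq v <- t | k v == b] = [::] by apply: filt0 => v; lia.
  by rewrite [in LHS]IH F1 F2.
- have F1 : [seq v <- t | k v < b] = [::] by apply: filt0 => v; lia.
  by rewrite [in LHS]IH F1.
Qed.

(* The predecessor of the first vertex is the last one. *)
Definition cyclic_claims (T C : Type) (typ : pred T) (dec : T -> seq C) (t : seq T) :=
  claims typ dec (last false (map typ t)) t.

(** Cutting the cycle elsewhere keeps the cyclic predecessor of every vertex. *)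
Lemma cyclic_claims_rot (T : Type) (C : eqType) (typ : pred T) (dec : T -> seq C) i t :
  perm_eq (cyclic_claims typ dec (rot i t)) (cyclic_claims typ dec t).
Proof.
rewrite /rot -{3}(cat_take_drop i t); move: (take i t) (drop i t) => t1 t2.
case: t1 => [|a1 t1]; first by rewrite cats0.
case: t2 => [|a2 t2]; first by rewrite cats0.
by rewrite /cyclic_claims !claims_cat !map_cat !last_cat /= perm_catC.
Qed.

Definition sol_of (cyc : bool) n (G : digraph n) : seq 'I_n -> bool :=
  if cyc then ham_cycle G else ham_path G.

Section Chain.
Variables (n' q m : nat) (cyc : bool) (g : nat -> rel nat).
Hypotheses (q0 : 0 < q) (mE : m = n' %/ q) (m0 : 0 < m).
Hypothesis g_irr : forall b u, g b u u = false.

Local Notation n := n'.+1.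

Definition blk (v : 'I_n) : nat := v %/ q.
Definition off (v : 'I_n) : nat := v %% q.

(* The last, incomplete block is a transitive tournament; its last vertex [n'] is
   a sink, from which arcs to all other vertices are added if [cyc] holds. *)
Definition chain_arc : rel 'I_n := fun u v =>
  (blk u < blk v) || ((blk u == blk v) &&
    (if blk u < m then g (blk u) (off u) (off v) else u < v)).

Definition full_arc : rel 'I_n := fun u v =>
  chain_arc u v || [&& cyc, u == n' :> nat & v != n' :> nat].

Lemma full_arc_irr u : full_arc u u = false.
Proof.
rewrite /full_arc /chain_arc !ltnn eqxx g_irr if_same /=.
by case: (_ == n'); rewrite !andbF.
Qed.

Lemma chain_loopless (x : 'I_n) : (x, x) \notin [set e | full_arc e.1 e.2].
Proof. by rewrite inE full_arc_irr. Qed.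

Definition chain_digraph : digraph n := Digraph chain_loopless.

Lemma arc_chain u v : arc chain_digraph u v = full_arc u v.
Proof. by rewrite /arc inE. Qed.

Lemma blk_le u : blk u <= m.
Proof. by rewrite /blk mE; apply: leq_div2r; rewrite -ltnS. Qed.

(** Vertices of different blocks are adjacent, so an independent set lies in one block; in the last
    block it has at most one vertex. *)
Lemma chain_independence (alpha : nat) : 0 < alpha ->
  (forall b s, b < m -> uniq s -> all (gtn q) s ->
    {in s &, forall u v, ~~ g b u v} -> size s <= alpha) ->
  independence_number chain_digraph <= alpha.
Proof.
move=> a0 H; apply/bigmax_leqP => I /forall_inP indI.
have noarc u v : u \in I -> v \in I -> ~~ full_arc u v.
  move=> uI vI; have /forall_inP/(_ v vI) := indI u uI.
  by rewrite /adjacent !arc_chain negb_or => /andP[].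
have same u v : u \in I -> v \in I -> blk u = blk v.
  move=> uI vI; have := noarc _ _ uI vI; have := noarc _ _ vI uI.
  by rewrite /full_arc /chain_arc; case: (ltngtP (blk u) (blk v)).
case: (set_0Vmem I) => [->|[w wI]]; first by rewrite cards0.
case: (ltnP (blk w) m) => [wm|mw].
  rewrite cardE -(size_map off); apply: (H (blk w)) => //.
  - rewrite map_inj_in_uniq ?enum_uniq // => u v; rewrite !mem_enum => uI vI /= E.
    by apply: val_inj; rewrite /= (divn_eq u q) (divn_eq v q) -/(blk u) -/(blk v)
      (same u v) // -/(off u) E.
  - by apply/allP => _ /mapP[u _ ->] /=; rewrite ltn_mod.
  - move=> _ _ /mapP[u + ->] /mapP[v + ->]; rewrite !mem_enum => uI vI.
    have := noarc _ _ uI vI; rewrite /full_arc /chain_arc (same u v) // (same v w) //.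
    by rewrite ltnn eqxx wm /=; apply: contra => ->.
apply: leq_trans a0; rewrite -[X in _ <= X](cards1 w); apply: subset_leq_card.
apply/fintype.subsetP => u uI; rewrite inE -val_eqE /=.
have := noarc _ _ uI wI; have := noarc _ _ wI uI; rewrite /full_arc /chain_arc.
by rewrite (same u w) // ltnn eqxx ltnNge mw /=; lia.
Qed.

Definition chain_sol : seq 'I_n -> bool := sol_of cyc chain_digraph.

Lemma blk_inord b o : b < m -> o < q -> blk (inord (b * q + o)) = b /\
  off (inord (b * q + o)) = o.
Proof.
move=> bm oq; have lt : b * q + o < n.
  have : b.+1 * q <= m * q by rewrite leq_mul2r bm orbT.
  have : m * q <= n' by rewrite mE leq_divM.
  by lia.
by rewrite /blk /off inordK // divnMDl // divn_small // addn0 modnMDl modn_small.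
Qed.

Lemma chain_prefix : (forall b, b < m -> exists s, gadget_ham (g b) q s) ->
  forall j, j <= m -> exists t : seq 'I_n,
    [/\ uniq t, sorted chain_arc t & t =i [pred v | blk v < j]].
Proof.
move=> H; elim=> [|j IH] jm; first by exists [::].
have [t [tu ts tE]] := IH (ltnW jm).
have [s /andP[sP sS]] := H j jm.
have sq o : (o \in s) = (o < q) by rewrite (perm_mem sP) mem_iota.
pose f o : 'I_n := inord (j * q + o).
have fE o : o \in s -> blk (f o) = j /\ off (f o) = o.
  by rewrite sq; apply: blk_inord.
exists (t ++ map f s); split.
- rewrite cat_uniq tu /= map_inj_in_uniq; last first.
    by move=> o1 o2 /fE[_ E1] /fE[_ E2] E; rewrite -E1 -E2 E.
  rewrite (perm_uniq sP) iota_uniq andbT; apply/hasPn => _ /mapP[z zS ->].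
  have [E _] := fE _ zS; by rewrite tE inE E ltnn.
- apply: sorted_cat_all => //; last first.
    move=> u _ + /mapP[z zS ->]; have [E _] := fE _ zS; rewrite tE inE => uj.
    by rewrite /chain_arc E uj.
  rewrite sorted_map; apply: sub_in_sorted sS; last first.
    by apply/allP => o os; exact: os.
  move=> o1 o2 /fE[E1 E1'] /fE[E2 E2'] G.
  by rewrite /= /chain_arc E1 E2 E1' E2' ltnn eqxx jm.
- move=> v; rewrite mem_cat tE !inE [in RHS]ltnS [in RHS]leq_eqVlt [in RHS]orbC.
  congr (_ || _).
  apply/mapP/eqP => [[z zS ->]|E]; first by have [] := fE _ zS. exists (off v).
    by rewrite sq ltn_mod.
  by rewrite /f -E /blk /off -divn_eq inord_val.
Qed.

Lemma chain_sol_exists : (forall b, b < m -> exists s, gadget_ham (g b) q s) ->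
  exists t, chain_sol t.
Proof.
move=> /chain_prefix/(_ m (leqnn m)) [t0 [tu ts tE]].
have mq : m * q <= n' by rewrite mE leq_divM.
pose p : seq 'I_n := map inord (iota (m * q) (n - m * q)).
have pE (v : 'I_n) : (v \in p) = (blk v == m).
  rewrite eqn_leq blk_le /= /blk leq_divRL //; apply/mapP/idP => [[z + ->]|mv].
    by rewrite mem_iota => ?; rewrite inordK; lia.
  exists (val v); last by rewrite inord_val.
  by rewrite mem_iota mv subnKC ?ltn_ord // ltnW.
have pu : uniq p.
  rewrite map_inj_in_uniq ?iota_uniq // => x y; rewrite !mem_iota => xi yi E.
  by rewrite -(@inordK n' x) ?E ?inordK; lia.
have pl x : last x p = ord_max.
  (* The last block is nonempty: [m] is the quotient of [n'], not of [n], so [n'] lies outside the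
     [m] complete blocks. *)
  rewrite /p; have -> : n - m * q = (n' - m * q).+1 by lia.
  rewrite -[(n' - m * q).+1]addn1 iotaD map_cat last_cat /=; apply: val_inj.
  by rewrite /= inordK; lia.
have ps : sorted chain_arc p.
  rewrite /p sorted_map.
  apply: (@sub_in_sorted _ (mem (iota (m * q) (n - m * q))) ltn); last first.
  - exact: iota_ltn_sorted.
  - by apply/allP.
  move=> x y xi yi xy.
  have := pE (inord x); have := pE (inord y); rewrite !map_f // => /esym/eqP Ey /esym/eqP Ex.
  rewrite /= /chain_arc Ex Ey ltnn eqxx /= !inordK //.
  - by move: yi; rewrite mem_iota; lia.
  - by move: xi; rewrite mem_iota; lia.
pose t := t0 ++ p.
have Tu : uniq t.
  rewrite cat_uniq tu pu andbT; apply/hasPn => v; rewrite pE tE inE => /eqP->.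
  by rewrite ltnn.
have Tm v : v \in t.
  by rewrite mem_cat tE pE inE orbC -leq_eqVlt blk_le.
have Tz : size t = n.
  rewrite -(card_uniqP Tu) -[RHS]card_ord; apply: eq_card => v.
  by rewrite Tm.
have Ts : sorted (arc chain_digraph) t.
  apply: (sub_sorted (e := chain_arc)).
    by move=> u v; rewrite arc_chain /full_arc => ->.
  apply: sorted_cat_all => // u v; rewrite tE pE inE /chain_arc => uj /eqP->.
  by rewrite uj.
exists t; rewrite /chain_sol /sol_of; case: ifP => cy; last first.
  by rewrite /ham_path Tu Tz eqxx.
rewrite /ham_cycle Tu Tz eqxx /=.
have n0 : 0 < n' by apply: leq_trans mq; rewrite muln_gt0 m0.
have : last ord0 t = ord_max by rewrite /t last_cat pl.
case: (t) Tu Tz Ts => [|x r] //= /andP[xr _] [sz] Ts lx.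
rewrite rcons_path Ts lx arc_chain /full_arc cy eqxx /= orbC.
have [/eqP xE|//] := boolP (x == n' :> nat).
case: r xr sz lx {Ts} => [|y r] /=; first by lia.
move=> + _ lx; have -> : x = last y r by rewrite lx; apply: val_inj.
by rewrite mem_last.
Qed.

Lemma mem_full (t : seq 'I_n) v : uniq t -> size t = n -> v \in t.
Proof.
move=> /card_uniqP tc ts; have := subset_cardP (A := mem t) (B := predT).
by rewrite tc ts card_ord => /(_ erefl (subset_predT _)) ->.
Qed.

(** A cycle is cut behind the sink [n'], so that the resulting path uses none of the arcs leaving
    [n']. *)
Lemma chain_sol_rot t : chain_sol t -> exists i,
  [/\ uniq (rot i t), size (rot i t) = n & sorted chain_arc (rot i t)].
Proof.
rewrite /chain_sol /sol_of; case: ifP => cy; last first.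
  case/and3P=> tu /eqP ts tS; exists 0; rewrite rot0; split=> //.
  apply: sub_sorted tS => u v.
  by rewrite arc_chain /full_arc cy orbF.
case/and3P=> tu /eqP ts tC; have tm := mem_full ord_max tu ts.
exists (index ord_max t).+1; split; rewrite ?rot_uniq ?size_rot //.
have := tC; rewrite -(rot_cycle (index ord_max t)).
have := tu; rewrite -(rot_uniq (index ord_max t)).
rewrite rotS ?index_mem // rot_index //; move: (_ ++ _) => s.
rewrite rot1_cons /= => /andP[zs _] /path_sorted.
elim: s zs => [|x s IH] //=; rewrite inE negb_or => /andP[zx zs].
case: s IH zs => [|y s] IH zs /= /andP[xy H]; apply/andP; split.
- move: xy; rewrite arc_chain /full_arc cy /= => /orP[//|/andP[/eqP E _]].
  by move: zx; rewrite -val_eqE /= E eqxx.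
- by [].
- move: xy; rewrite arc_chain /full_arc cy /= => /orP[//|/andP[/eqP E _]].
  by move: zx; rewrite -val_eqE /= E eqxx.
- exact: (IH zs H).
Qed.

Variables (typ : pred nat) (dec : nat -> seq bool).

Definition chain_typ (v : 'I_n) := (blk v < m) && typ (off v).
Definition chain_dec (v : 'I_n) : seq (nat * bool) :=
  if blk v < m then map (pair (blk v)) (dec (off v)) else [::].

Lemma chain_claims_blk l t b : {in t, forall v, blk v != b} ->
  [seq c <- claims chain_typ chain_dec l t | c.1 == b] = [::].
Proof.
elim: t l => [|v t IH] l //= H; rewrite filter_cat IH ?cats0; last first.
  by move=> w wt; apply: H; rewrite inE wt orbT.
have vb := H v (mem_head _ _).
case: l => //; rewrite /chain_dec; case: ifP => // _; rewrite filter_map /=.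
by rewrite (eq_filter (a2 := pred0)) ?filter_pred0 // => x /=; apply/negbTE.
Qed.

Lemma chain_claims_local l t b : b < m -> {in t, forall v, blk v = b} ->
  claims chain_typ chain_dec l t = map (pair b) (claims typ dec l (map off t)).
Proof.
move=> bm; elim: t l => [|v t IH] l //= H; rewrite IH; last first.
  by move=> w wt; apply: H; rewrite inE wt orbT.
have vb := H v (mem_head _ _).
rewrite map_cat /chain_typ /chain_dec vb bm /=; congr (_ ++ _).
by case: l.
Qed.

(** Block numbers never decrease along chain arcs, so the cut path visits block [b] in one stretch,
    a Hamiltonian path of its gadget. The type [l] of the vertex before the stretch is arbitrary. *)
Lemma chain_claims t b c : b < m -> chain_sol t ->
  (forall l s, gadget_ham (g b) q s -> claims typ dec l s = [:: c]) ->
  [seq d <- cyclic_claims chain_typ chain_dec t | d.1 == b] = [:: (b, c)].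
Proof.
move=> bm /chain_sol_rot[i [tu ts tS]] H.
have := perm_filter (fun d : nat * bool => d.1 == b)
  (cyclic_claims_rot chain_typ chain_dec i t).
move: (rot i t) tu ts tS => t' tu ts tS.
suff -> : [seq d <- cyclic_claims chain_typ chain_dec t' | d.1 == b] = [:: (b, c)].
  by rewrite perm_sym => /perm_small_eq ->.
rewrite /cyclic_claims; move: (last false _) => l.
have kS : sorted (fun u v => blk u <= blk v) t'.
  apply: sub_sorted tS => u v; rewrite /chain_arc.
  by case/orP => [/ltnW//|/andP[/eqP->]].
rewrite (sorted_key_split b kS) !claims_cat !filter_cat.
have B1 : {in [seq v <- t' | blk v < b], forall v, blk v != b}.
  by move=> v; rewrite mem_filter => /andP[]; lia.
have B2 : {in [seq v <- t' | b < blk v], forall v, blk v != b}.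
  by move=> v; rewrite mem_filter => /andP[]; lia.
rewrite (chain_claims_blk _ B1) (chain_claims_blk _ B2).
rewrite cats0 /=; set tb := [seq v <- t' | blk v == b].
have tbE : {in tb, forall v, blk v = b} by move=> v; rewrite mem_filter => /andP[/eqP].
rewrite (chain_claims_local _ bm tbE) H /=; first by rewrite eqxx.
apply/andP; split.
  apply: uniq_perm.
  - rewrite map_inj_in_uniq ?filter_uniq // => u v /tbE ub /tbE vb E.
    by apply: val_inj; rewrite /= (divn_eq u q) (divn_eq v q) -/(blk u) -/(blk v)
      ub vb -/(off u) E.
  - exact: iota_uniq.
  - move=> z; rewrite mem_iota add0n; apply/mapP/idP => [[v _ ->]|zq].
      by rewrite /= ltn_mod.
    have [E1 E2] := blk_inord bm zq.
    exists (inord (b * q + z)); last by rewrite E2.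
    rewrite mem_filter E1 eqxx /=.
    exact: mem_full.
rewrite sorted_map.
have : sorted chain_arc tb.
  move: tS; rewrite {1}(sorted_key_split b kS) -/tb => /cat_sorted2[_].
  by case/cat_sorted2.
apply: (@sub_in_sorted _ (mem tb)); last by apply/allP.
by move=> u v ub vb; rewrite /= /chain_arc (tbE u) // (tbE v) // ltnn eqxx bm.
Qed.

End Chain.

(** * Transcripts of streaming algorithms *)

Definition one_claims (ca cb : option bool) (c : bool) :=
  (ca == Some c) && (cb == None) || (ca == None) && (cb == Some c).

Section Turns.
Variables (X Y V : Type) (M : finType) (init : M) (fin : M -> seq V).
Variables (rA : X -> M -> M * seq V) (rB : Y -> M -> M * seq V) (p : nat).
Variables (typ : pred V) (dec : V -> seq (nat * bool)).

(* A state carries, besides the memory, the type of the last vertex written so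
   far. *)
Definition turn_state : finType := (M * option bool)%type.
Implicit Types (st : turn_state).

Definition track (r : M -> M * seq V) st : turn_state :=
  ((r st.1).1, last st.2 (map (Some \o typ) (r st.1).2)).

Definition pass_state x y st := track (rB y) (track (rA x) st).
Definition pass_tape x y st :=
  (rA x st.1).2 ++ (rB y (track (rA x) st).1).2.

Definition state0 : turn_state := (init, None).
Definition state x y k := iter k (pass_state x y) state0.
Definition tape x y k := flatten [seq pass_tape x y (state x y j) | j <- iota 0 k].

Definition transcript : finType := (p.-tuple (turn_state * turn_state))%type.
Implicit Types (t : transcript).

Definition transcript_of x y : transcript :=
  [tuple (track (rA x) (state x y k), state x y k.+1) | k < p].

Definition prev_state t k := nth state0 (state0 :: map snd t) k.
Definition mid_state t k := nth state0 (map fst t) k.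

Definition consA t x := [forall k : 'I_p, track (rA x) (prev_state t k) == mid_state t k].
Definition consB t y := [forall k : 'I_p, track (rB y) (mid_state t k) == prev_state t k.+1].

Lemma nth_trans x y k : k < p -> nth (state0, state0) (transcript_of x y) k =
  (track (rA x) (state x y k), state x y k.+1).
Proof.
move=> kp; have := tnth_nth (state0, state0) (transcript_of x y) (Ordinal kp).
by rewrite tnth_mktuple => <-.
Qed.

Lemma mid_trans x y k : k < p -> mid_state (transcript_of x y) k = track (rA x) (state x y k).
Proof.
move=> kp; rewrite /mid_state (nth_map (state0, state0)) ?size_tuple ?card_ord //.
by rewrite nth_trans.
Qed.

Lemma prev_trans x y k : k <= p -> prev_state (transcript_of x y) k = state x y k.
Proof.
case: k => // k kp; rewrite /prev_state [nth _ _ _]/=.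
rewrite (nth_map (state0, state0)) ?size_tuple ?card_ord //.
by rewrite nth_trans.
Qed.

(** A transcript records the state after every turn, so each player's turns can be checked
    separately. The inputs leading to [t] form a rectangle, the source of the cut-and-paste
    identity. *)
Lemma transP x y t : (transcript_of x y == t) = consA t x && consB t y.
Proof.
apply/eqP/andP => [<-|[/forallP cA /forallP cB]].
  split; apply/forallP => k; rewrite mid_trans // ?prev_trans //.
  by rewrite ltnW.
have sE k : k <= p -> state x y k = prev_state t k.
  elim: k => // k IH kp; rewrite /state iterS -/(state x y k) IH ?(ltnW kp) //.
  rewrite /pass_state (eqP (cA (Ordinal kp))); exact/eqP/(cB (Ordinal kp)).
apply: eq_from_tnth => k; rewrite tnth_mktuple (sE k) ?(ltnW (ltn_ord k)) //.
rewrite (sE k.+1) // (eqP (cA k)) /mid_state /prev_state /=.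
by rewrite !(nth_map (state0, state0)) ?size_tuple ?card_ord // -!tnth_nth -surjective_pairing.
Qed.

(** The type of the last vertex of the whole tape, which cyclically precedes the first one; it
    stands in for [None] until a vertex is written. *)
Definition last_typ t :=
  last (odflt false (prev_state t p).2) (map typ (fin (prev_state t p).1)).

(** The transcript and [x] alone tell which of the vertices written by Alice are decisive. The final
    output is attributed to Bob. *)
Definition claimsA t x := flatten
  [seq claims typ dec (odflt (last_typ t) (prev_state t k).2) (rA x (prev_state t k).1).2
     | k <- iota 0 p].
Definition claimsB t y := flatten
  [seq claims typ dec (odflt (last_typ t) (mid_state t k).2) (rB y (mid_state t k).1).2
     | k <- iota 0 p] ++
  claims typ dec (odflt (last_typ t) (prev_state t p).2) (fin (prev_state t p).1).

Lemma odflt_last l o (s : seq V) :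
  odflt l (last o (map (Some \o typ) s)) = last (odflt l o) (map typ s).
Proof. by elim: s o => [|v s IH] o //=; rewrite IH. Qed.

Lemma tapeS x y k : tape x y k.+1 = tape x y k ++ pass_tape x y (state x y k).
Proof. by rewrite /tape -addn1 iotaD map_cat flatten_cat /= cats0. Qed.

Lemma last_tape x y k l : last l (map typ (tape x y k)) = odflt l (state x y k).2.
Proof.
elim: k => // k IH; rewrite tapeS map_cat last_cat IH /pass_tape map_cat last_cat.
by rewrite -!odflt_last.
Qed.

(** The claims in a piece of the tape depend on what precedes only through the type of the last
    vertex before it, which the states carry. *)
Lemma claims_perm x y :
  perm_eq (cyclic_claims typ dec (tape x y p ++ fin (state x y p).1))
    (claimsA (transcript_of x y) x ++ claimsB (transcript_of x y) y).
Proof.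
set t := transcript_of x y; rewrite /cyclic_claims map_cat last_cat last_tape.
have -> : last (odflt false (state x y p).2) (map typ (fin (state x y p).1)) = last_typ t.
  by rewrite /last_typ prev_trans.
rewrite claims_cat last_tape /claimsA /claimsB prev_trans // catA perm_cat2r.
move: (last_typ t) => l.
suff H k : k <= p -> perm_eq (claims typ dec l (tape x y k))
    (flatten [seq claims typ dec (odflt l (prev_state t k).2)
                                 (rA x (prev_state t k).1).2 | k <- iota 0 k] ++
     flatten [seq claims typ dec (odflt l (mid_state t k).2)
                                 (rB y (mid_state t k).1).2 | k <- iota 0 k]).
  exact: H.
elim: k => [|k IH] kp; first by rewrite /tape /= perm_refl.
rewrite tapeS claims_cat last_tape -[k.+1]addn1 !iotaD !map_cat !flatten_cat /= !cats0.
rewrite prev_trans ?(ltnW kp) // mid_trans //.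
rewrite /pass_tape claims_cat -odflt_last perm_sym perm_catACA perm_sym.
by rewrite perm_cat2r; apply: IH; apply: ltnW.
Qed.

Definition sole (l : seq (nat * bool)) (b : nat) : option bool :=
  if [seq d <- l | d.1 == b] is [:: d] then Some d.2 else None.

Lemma one_claims_tape x y b c (t := transcript_of x y) :
  [seq d <- cyclic_claims typ dec (tape x y p ++ fin (state x y p).1) | d.1 == b]
    = [:: (b, c)] ->
  one_claims (sole (claimsA t x) b) (sole (claimsB t y) b) c.
Proof.
move=> E; have := perm_filter (fun d : nat * bool => d.1 == b) (claims_perm x y).
rewrite E filter_cat /sole -/t.
case: [seq d <- claimsA t x | d.1 == b] => [|d1 [|d2 s1]];
  case: [seq d <- claimsB t y | d.1 == b] => [|d3 [|d4 s2]] //= H;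
  have := perm_size H => //= _; move: H;
  rewrite perm_sym => /perm_small_eq => /(_ isT) [] // ->;
  by rewrite /one_claims /= eqxx.
Qed.

End Turns.

(** * Runs of a streaming algorithm as alternating turns *)

Section Feed.
Variables (n s : nat) (A : streaming_alg n s).

Definition feed (S : seq ('I_n * 'I_n)) (c : config n s) : config n s :=
  foldl (fun c e => emit (fun m => alg_step A m e) c) c S.

Lemma feedE S mem o :
  feed S (mem, o) = ((feed S (mem, [::])).1, o ++ (feed S (mem, [::])).2).
Proof.
elim: S mem o => [|e S IH] mem o; first by rewrite /= cats0.
by rewrite /= IH [in RHS]IH /= catA.
Qed.

Variables (X Y : Type) (SA : X -> seq ('I_n * 'I_n)) (SB : Y -> seq ('I_n * 'I_n)).
Variable typ : pred 'I_n.

Definition turnA x mem := feed (SA x) (mem, [::]).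
Definition turnB y mem := emit (alg_end_pass A) (feed (SB y) (mem, [::])).

Local Notation st := (state (alg_init A) turnA turnB typ).
Local Notation tp := (tape (alg_init A) turnA turnB typ).

Lemma output_tape p x y :
  output A p (SA x ++ SB y) = tp x y p ++ alg_final A (st x y p).1.
Proof.
rewrite /output; suff -> : iter p (run_pass A (SA x ++ SB y)) (alg_init A, [::]) =
  ((st x y p).1, tp x y p) by [].
elim: p => // p IH; rewrite iterS IH tapeS /run_pass foldl_cat -!/(feed _ _).
have -> : (st x y p.+1).1 = (turnB y (turnA x (st x y p).1).1).1 by [].
rewrite /pass_tape /track /= feedE /turnB /turnA.
by case: (feed (SA x) _) => [mem o]; rewrite feedE /emit /= !catA.
Qed.

End Feed.

(** * Chains of gadgets as streams of two players *)

Section Protocol.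
Variables (n' q m : nat) (cyc : bool) (bp : rel nat) (X Y : Type).
Variables (gA : X -> nat -> rel nat) (gB : Y -> nat -> rel nat).
Hypotheses (q0 : 0 < q) (mE : m = n' %/ q) (m0 : 0 < m).
Definition blocks x y b := gadget bp (gA x b) (gB y b).
Hypothesis irr : forall x y b u, blocks x y b u u = false.

Local Notation n := n'.+1.
Local Notation blk := (@blk n' q).
Local Notation off := (@off n' q).

(** The arcs between blocks, inside the last block and out of [n'] do not depend on the inputs and
    all go to Alice. *)
Definition bob_pair (e : 'I_n * 'I_n) :=
  [&& blk e.1 == blk e.2, blk e.1 < m & bp (off e.1) (off e.2)].

Definition streamA x := [seq e <- enum {: 'I_n * 'I_n} |
  ~~ bob_pair e && full_arc q m cyc (gA x) e.1 e.2].
Definition streamB y := [seq e <- enum {: 'I_n * 'I_n} |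
  bob_pair e && full_arc q m cyc (gB y) e.1 e.2].

Lemma full_arc_split x y e : full_arc q m cyc (blocks x y) e.1 e.2 =
  if bob_pair e then full_arc q m cyc (gB y) e.1 e.2 else full_arc q m cyc (gA x) e.1 e.2.
Proof.
rewrite /full_arc /chain_arc /bob_pair /blocks /gadget.
case: (blk e.1 == blk e.2) => //=.
by case: (blk e.1 < m) => //=; case: (bp _ _).
Qed.

Lemma arrival_stream x y :
  arrival_order (@chain_digraph n' q m cyc (blocks x y) (irr x y)) (streamA x ++ streamB y).
Proof.
apply: uniq_perm; rewrite ?enum_uniq //.
  have U := enum_uniq {: 'I_n * 'I_n}.
  rewrite cat_uniq (filter_uniq _ U) (filter_uniq _ U) /= andbT.
  apply/hasPn => e; rewrite !mem_filter.
  by case: (bob_pair e).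
move=> e; rewrite mem_cat !mem_filter -!enumT !mem_enum !inE (full_arc_split x y).
by case: (bob_pair e); rewrite /= ?andbT ?orbF.
Qed.

Variables (s : nat) (A : streaming_alg n s) (p : nat).
Variables (typ : pred nat) (dec : nat -> seq bool).

Local Notation rA := (turnA A streamA).
Local Notation rB := (turnB A streamB).

Definition run_claimA t x b := sole (@claimsA _ _ _ (alg_init A) (alg_final A) rA p
  (@chain_typ n' q m typ) (@chain_dec n' q m dec) t x) b.
Definition run_claimB t y b := sole (@claimsB _ _ _ (alg_init A) (alg_final A) rB p
  (@chain_typ n' q m typ) (@chain_dec n' q m dec) t y) b.

Lemma run_claims x y b c
  (t := transcript_of (alg_init A) rA rB p (@chain_typ n' q m typ) x y) : b < m ->
  @chain_sol n' q m cyc (blocks x y) (irr x y) (output A p (streamA x ++ streamB y)) ->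
  (forall l u, gadget_ham (blocks x y b) q u -> claims typ dec l u = [:: c]) ->
  one_claims (run_claimA t x b) (run_claimB t y b) c.
Proof.
move=> bm; rewrite (output_tape _ _ _ (@chain_typ n' q m typ)) => H1 H2.
by apply: one_claims_tape; apply: chain_claims bm H1 H2.
Qed.

End Protocol.

Lemma card_transcript (s p : nat) :
  #|transcript (s.-tuple bool) p| = ((2 ^ s * 3) ^ 2) ^ p.
Proof.
by rewrite card_tuple !card_prod card_option card_bool card_tuple card_bool.
Qed.

(** * Counting bound for the parity gadget *)

Section XorBound.
Variable m : nat.
Local Notation word := {ffun 'I_m -> bool}.

Definition silent (c : 'I_m -> option bool) := #|[pred b | c b == None]|.

(** Where [c] gives the parity, [x b] determines [y b]; only the silent blocks leave a choice. *)
Lemma card_forced (x : word) (c : 'I_m -> option bool) :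
  #|[pred y : word | [forall b, (c b == None) || (c b == Some (x b (+) y b))]]|
    <= 2 ^ silent c.
Proof.
pose F b : pred bool := if c b is Some v then pred1 (x b (+) v) else predT.
have -> : 2 ^ silent c = #|family F|.
  rewrite card_family foldrE big_map big_enum /= (bigID [pred b | c b == None]) /=.
  rewrite [X in _ * X]big1 ?muln1; last first.
    by move=> b; rewrite /F; case: (c b) => // v _; rewrite card1.
  rewrite (eq_bigr (fun=> 2)); last first.
    by move=> b /eqP; rewrite /F => ->; rewrite card_bool.
  by rewrite prod_nat_const.
apply/subset_leq_card/fintype.subsetP => y; rewrite !inE => /forallP H.
apply/familyP => b; have := H b; rewrite /F; case: (c b) => //= v /eqP[->].
by rewrite inE addbA addbb.
Qed.

Lemma card_fibers (S T : finType) (P : S -> T -> bool) k :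
  (forall x, #|[pred y | P x y]| <= k) -> #|[pred w : S * T | P w.1 w.2]| <= #|S| * k.
Proof.
move=> H; rewrite -sum1_card.
rewrite (_ : \sum_(w in _) 1 = \sum_(w : S * T | predT w.1 && P w.1 w.2) 1) //.
rewrite -(pair_big_dep predT P (fun _ _ => 1)) /= -sum_nat_const.
by apply: leq_sum => x _; apply: leq_trans (H x); rewrite -sum1_card.
Qed.

Lemma card_swap (S T : finType) (P : S -> T -> bool) :
  #|[pred w : S * T | P w.1 w.2]| = #|[pred w : T * S | P w.2 w.1]|.
Proof.
rewrite -!sum1_card (reindex (fun w : T * S => (w.2, w.1))) //=.
by exists (fun w => (w.2, w.1)) => -[].
Qed.

(* The partner of a party with few silent blocks is almost determined, and the
   silences of the two parties add up to [m]. *)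
Lemma xor_count (ca cb : word -> 'I_m -> option bool) :
  #|[pred w : word * word |
      [forall b, one_claims (ca w.1 b) (cb w.2 b) (w.1 b (+) w.2 b)]]|
    <= 2 ^ m * 2 ^ m./2 + 2 ^ m * 2 ^ m./2.
Proof.
pose G (x y : word) := [forall b, one_claims (ca x b) (cb y b) (x b (+) y b)].
have cm : 2 ^ m = #|{: word}| by rewrite card_ffun card_bool card_ord.
have forced x y : G x y ->
    [forall b, (ca x b == None) || (ca x b == Some (x b (+) y b))] /\
    [forall b, (cb y b == None) || (cb y b == Some (y b (+) x b))].
  move=> /forallP H; split; apply/forallP => b; have := H b; rewrite /one_claims.
    by case/orP=> /andP[-> _]; rewrite ?orbT.
  by rewrite addbC; case/orP=> /andP[_ ->]; rewrite ?orbT.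
have silE x y : G x y -> silent (ca x) + silent (cb y) = m.
  move=> /forallP H; rewrite -[RHS]card_ord /silent.
  have -> : #|[pred b | cb y b == None]| = #|[predC [pred b | ca x b == None]]|.
    apply: eq_card => b; have := H b; rewrite !inE /one_claims.
    by case/orP=> /andP[/eqP-> /eqP->].
  by rewrite cardC.
rewrite -(cardID [pred w | silent (ca w.1) <= m./2]); apply: leq_add.
  apply: leq_trans (_ : #|[pred w : word * word | G w.1 w.2 && (silent (ca w.1) <= m./2)]| <= _).
    by apply/eq_leq/eq_card => w; rewrite !inE andbC.
  rewrite cm; apply: (card_fibers (P := fun x y => G x y && (silent (ca x) <= m./2))) => x.
  case: (leqP (silent (ca x)) m./2) => sx; last first.
    by rewrite (eq_card (B := pred0)) ?card0 // => y; rewrite !inE andbF.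
  apply: leq_trans (leq_pexp2l _ sx) => //; apply: leq_trans (card_forced x (ca x)).
  apply/subset_leq_card/fintype.subsetP => y; rewrite !inE andbT.
  by case/forced.
apply: leq_trans (_ : #|[pred w : word * word | G w.1 w.2 && (silent (cb w.2) <= m./2)]| <= _).
  apply/subset_leq_card/fintype.subsetP => -[x y]; rewrite !inE -ltnNge /= => /andP[s1 Gxy].
  have G' : G x y by []. rewrite G' /=; have := silE _ _ G'; lia.
rewrite (card_swap (fun x y => G x y && (silent (cb y) <= m./2))) cm.
apply: (card_fibers (P := fun y x => G x y && (silent (cb y) <= m./2))) => y.
case: (leqP (silent (cb y)) m./2) => sy; last first.
  by rewrite (eq_card (B := pred0)) ?card0 // => x; rewrite !inE andbF.
apply: leq_trans (leq_pexp2l _ sy) => //; apply: leq_trans (card_forced y (cb y)).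
apply/subset_leq_card/fintype.subsetP => x; rewrite !inE andbT.
by case/forced.
Qed.

(** Once the transcript is fixed, the claims of each player depend on one word only, and [xor_count]
    applies. *)
Lemma xor_bound (P : finType) (tr : word -> word -> P)
    (ca cb : P -> word -> 'I_m -> option bool) :
  #|[pred w : word * word | [forall b,
      one_claims (ca (tr w.1 w.2) w.1 b) (cb (tr w.1 w.2) w.2 b) (w.1 b (+) w.2 b)]]|
    <= #|P| * (2 * 2 ^ (m + m./2)).
Proof.
apply: leq_trans (_ : \sum_(t : P) #|[pred w : word * word |
      [forall b, one_claims (ca t w.1 b) (cb t w.2 b) (w.1 b (+) w.2 b)]]| <= _).
  rewrite -sum1_card (partition_big (fun w => tr w.1 w.2) predT) //=.
  apply: leq_sum => t _; rewrite sum1_card; apply/subset_leq_card/fintype.subsetP => w.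
  by rewrite !inE => /andP[H /eqP <-].
rewrite -sum_nat_const; apply: leq_sum => t _.
by rewrite mul2n -addnn expnD; apply: xor_count.
Qed.
End XorBound.

Import Order.TTheory GRing.Theory Num.Theory.
Local Open Scope ring_scope.

(** * Information bound for the matrix gadget *)

Section LevelOne.
Variable R : realType.

Lemma expR_le_quad (t : R) : t <= 1 / 2 -> expR t <= 1 + t + 2 * t ^+ 2.
Proof.
move=> t2; have t1 : 0 < 1 - t by lra.
have : 1 - t <= expR (- t) by apply: expR_ge1Dx.
rewrite expRN => H; have e0 := expR_gt0 t.
have {}H : (1 - t) * expR t <= 1.
  by have := ler_wpM2r (ltW e0) H; rewrite mulVf ?gt_eqF.
(* [(1 - t) * (1 + t + 2 * t^2) = 1 + t^2 * (1 - 2 * t)], which is at least 1 here. *)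
rewrite -(ler_pM2l t1) (le_trans H) //; nra.
Qed.

Lemma cosh_le (t : R) : `|t| <= 1 / 2 -> expR t + expR (- t) <= 2 * expR (2 * t ^+ 2).
Proof.
rewrite ler_norml => /andP[h1 h2].
have := expR_le_quad h2; have : - t <= 1 / 2 by lra.
move=> /expR_le_quad; have := expR_ge1Dx (2 * t ^+ 2); nra.
Qed.

Variable T : finType.
Local Notation word := {ffun T -> bool}.
Definition sgb (c : bool) : R := if c then 1 else -1.
Local Notation N := ((2 ^ #|T|)%:R : R).

Lemma card_word : #|{: word}|%:R = N.
Proof. by rewrite card_ffun card_bool. Qed.

Lemma sum_word1 : \sum_(z : word) 1 = N.
Proof. by rewrite sumr_const card_word. Qed.

(** The [d i] are unnormalised degree-one Fourier coefficients of [f]. The exponential moment of a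
    linear form in the signs is bounded from below on [f] by convexity, and from above on the whole
    cube by independence. *)
Lemma level_one (f : pred word) (s := \sum_(z : word) (f z)%:R : R)
    (d := fun i => \sum_(z : word) sgb (z i) * (f z)%:R : R) : 0 < s ->
  \sum_i d i ^+ 2 <= 8 * s ^+ 2 * ln (N / s).
Proof.
move=> s0; pose b i := d i / s; pose B := \sum_i b i ^+ 2.
have b1 i : `|b i| <= 1.
  rewrite /b normrM normfV (gtr0_norm s0) ler_pdivrMr // mul1r.
  apply: le_trans (ler_norm_sum _ _ _) _; apply: ler_sum => z _.
  rewrite normrM /sgb; case: (z i); case: (f z);
  by rewrite ?normrN ?normr1 ?normr0 ?mulr0 ?mulr1.
(* With coefficients [l * b i] the gain is [l * B] and the cost [2 * l^2 * B]; the best choice is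
   [l = 1/4]. *)
pose u (z : word) := \sum_i b i / 4 * sgb (z i).
(* Jensen's inequality, from the tangent of [expR] at [B / 4], the mean of [u] over [f]. *)
have low : s * expR (B / 4) <= \sum_(z : word) (f z)%:R * expR (u z).
  have -> : s * expR (B / 4) = \sum_(z : word) (f z)%:R * (expR (B / 4) * (1 + (u z - B / 4))).
    have -> : \sum_(z : word) (f z)%:R * (expR (B / 4) * (1 + (u z - B / 4))) =
      expR (B / 4) * ((1 - B / 4) * s + \sum_(z : word) u z * (f z)%:R).
      rewrite mulrDr mulrA mulr_sumr mulr_sumr -big_split /=.
      by apply: eq_bigr => z _; ring.
    have -> : \sum_(z : word) u z * (f z)%:R = s * B / 4.
      under eq_bigr do rewrite mulr_suml.
      rewrite exchange_big /= /B mulr_sumr mulr_suml; apply: eq_bigr => i _.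
      under eq_bigr do rewrite -mulrA.
      rewrite -mulr_sumr -/(d i) /b; field.
      by rewrite gt_eqF.
    by field.
  apply: ler_sum => z _; apply: ler_wpM2l; first by rewrite ler0n.
  have -> : u z = B / 4 + (u z - B / 4) by ring.
  rewrite expRD ler_wpM2l ?expR_ge0 //.
  have -> : B / 4 + (u z - B / 4) - B / 4 = u z - B / 4 by ring.
  exact: expR_ge1Dx.
have up : \sum_(z : word) (f z)%:R * expR (u z) <= N * expR (B / 8).
  apply: (@le_trans _ _ (\sum_(z : word) \prod_i expR (b i / 4 * sgb (z i)))).
    apply: ler_sum => z _; rewrite /u expR_sum.
    apply: ler_piMl; last by case: (f z).
    by apply: prodr_ge0 => i _; exact: expR_ge0.
  rewrite -(bigA_distr_bigA (fun i c => expR (b i / 4 * sgb c))) /=.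
  have -> : N * expR (B / 8) = \prod_(i : T) (2 * expR (2 * (b i / 4) ^+ 2)).
    rewrite big_split /= prodr_const -natrX; congr (_ * _).
    rewrite -expR_sum; congr expR; rewrite /B mulr_suml; apply: eq_bigr => i _.
    by field.
  apply: ler_prod => i _; rewrite big_bool /= /sgb mulr1 mulrN1.
  rewrite addr_ge0 ?expR_ge0 //=; apply: cosh_le.
  rewrite normrM; have := b1 i; rewrite (ger0_norm (_ : 0 <= 4^-1 :> R)); lra.
have N0 : 0 < N by rewrite ltr0n expn_gt0.
have H : s * expR (B / 8) <= N.
  rewrite -(ler_pM2r (expR_gt0 (B / 8))) -mulrA -expRD.
  have -> : B / 8 + B / 8 = B / 4 by field.
  exact: le_trans low up.
have {}H : B / 8 <= ln (N / s).
  rewrite -[leLHS]expRK ler_ln ?posrE ?expR_gt0 ?divr_gt0 //.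
  by rewrite ler_pdivlMr // mulrC.
have -> : \sum_i d i ^+ 2 = s ^+ 2 * B.
  rewrite /B mulr_sumr; apply: eq_bigr => i _; rewrite /b; field.
  by rewrite gt_eqF.
have := sqr_ge0 s; nra.
Qed.

(** The entropy of the distribution [s t / n] is compared with that of the uniform one through
    [ln x <= x - 1]. *)
Lemma entropy_le (P : finType) (s : P -> R) (n : R) : (forall t, 0 <= s t) ->
  0 < n -> \sum_t s t = n -> \sum_t s t * ln (n / s t) <= n * ln (#|P|%:R).
Proof.
move=> s0 n0 sn; have P0 : 0 < #|P|%:R :> R.
  rewrite ltr0n lt0n; apply/eqP => P0; move: n0; rewrite -sn big1 ?ltxx // => t _.
  by have := card0_eq P0 t.
apply: (@le_trans _ _ (\sum_t (s t * ln #|P|%:R + (n / #|P|%:R - s t)))).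
  apply: ler_sum => t _; have := s0 t; rewrite le_eqVlt => /orP[/eqP<-|st].
    by rewrite !mul0r subr0 add0r divr_ge0 // ltW.
  have -> : n / s t = #|P|%:R * (n / (s t * #|P|%:R)).
    by field; rewrite !gt_eqF.
  have q0 : 0 < n / (s t * #|P|%:R) by rewrite divr_gt0 // mulr_gt0.
  rewrite lnM ?posrE // mulrDr lerD2l.
  have : ln (n / (s t * #|P|%:R)) <= n / (s t * #|P|%:R) - 1.
    rewrite lerBrDl -[leRHS]lnK ?posrE //; exact: expR_ge1Dx.
  move=> H; have := ler_wpM2l (ltW st) H; move/le_trans; apply.
  by rewrite le_eqVlt; apply/orP; left; apply/eqP; field; rewrite !gt_eqF.
rewrite big_split /= -mulr_suml sn sumrB sn.
have -> : \sum_(t : P) n / #|P|%:R = n.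
  by rewrite sumr_const -[LHS]mulr_natr divfK ?gt_eqF.
by rewrite subrr addr0.
Qed.

Definition setb (z : word) (i : T) (c : bool) : word :=
  [ffun w => if w == i then c else z w].

Lemma sum_setb (V : nmodType) (F : word -> V) i c :
  \sum_(z : word) F (setb z i c) = (\sum_(z : word | z i == c) F z) *+ 2.
Proof.
rewrite (bigID (fun z : word => z i == c)) /= mulr2n; congr (_ + _).
  apply: eq_bigr => z /eqP zc; congr F; apply/ffunP => w; rewrite ffunE.
  by case: eqP => // ->.
rewrite (reindex (fun z : word => setb z i (~~ z i))) /=; last first.
  exists (fun z : word => setb z i (~~ z i)) => z _; apply/ffunP => w;
  by rewrite !ffunE eqxx negbK; case: eqP => // ->.
apply: eq_big => z; first by rewrite ffunE eqxx; case: (z i); case: c.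
move=> zc; congr F; apply/ffunP => w; rewrite !ffunE.
case: eqP => // ->; move: zc; rewrite ffunE eqxx; by case: (z i); case: c.
Qed.

(** The squared Hellinger distance without the factor 1/2, for functions that need not sum to 1. *)
Definition hellinger (P : finType) (f g : P -> R) :=
  \sum_t (Num.sqrt (f t) - Num.sqrt (g t)) ^+ 2.

(** For each transcript the level-one inequality bounds the sum over coordinates by
    [16 * s * ln (N / s)], and the entropy bound sums this over transcripts. *)
Lemma info_bound (P : finType) (tr : word -> P) :
  \sum_i hellinger (fun t => \sum_(z : word) (tr (setb z i true) == t)%:R)
             (fun t => \sum_(z : word) (tr (setb z i false) == t)%:R)
    <= 16 * (N * ln (#|P|%:R)).
Proof.
pose s t : R := \sum_(z : word) (tr z == t)%:R.
pose d t i : R := \sum_(z : word) sgb (z i) * (tr z == t)%:R.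
have s0 t : 0 <= s t by apply: sumr_ge0.
have N0 : 0 < N by rewrite ltr0n expn_gt0.
have sN : \sum_t s t = N.
  rewrite exchange_big /= -sum_word1; apply: eq_bigr => z _.
  by rewrite (bigD1 (tr z)) //= eqxx big1 ?addr0 // => t /negbTE; rewrite eq_sym => ->.
have := entropy_le s0 N0 sN; rewrite -(ler_pM2l (_ : 0 < 16 :> R)) //.
move/(le_trans _); apply; rewrite /hellinger exchange_big mulr_sumr /=.
apply: ler_sum => t _.
pose p1 i : R := \sum_(z : word) (tr (setb z i true) == t)%:R.
pose p0 i : R := \sum_(z : word) (tr (setb z i false) == t)%:R.
rewrite -[leLHS]/(\sum_i (Num.sqrt (p1 i) - Num.sqrt (p0 i)) ^+ 2).
have ps i : p1 i + p0 i = 2 * s t.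
  rewrite /p1 /p0 !(sum_setb (fun z => (tr z == t)%:R)).
  rewrite -mulrnDl -[LHS]mulr_natl; congr (_ * _).
  rewrite /s [in RHS](bigID (fun z : word => z i == true)) /=; congr (_ + _).
  by apply: eq_bigl => z; case: (z i).
have pd i : p1 i - p0 i = 2 * d t i.
  rewrite /p1 /p0 !(sum_setb (fun z => (tr z == t)%:R)).
  rewrite -mulrnBl -[LHS]mulr_natl; congr (_ * _).
  rewrite /d [in RHS](bigID (fun z : word => z i == true)) /=; congr (_ + _).
    by apply: eq_bigr => z /eqP->; rewrite mul1r.
  rewrite -sumrN; apply: eq_big => z; first by case: (z i).
  by move=> /eqP->; rewrite mulN1r.
have p1_ge0 i : 0 <= p1 i by apply: sumr_ge0.
have p0_ge0 i : 0 <= p0 i by apply: sumr_ge0.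
have [st|] := ltP 0 (s t); last first.
  move=> h; have {h} st0 : s t = 0 by apply/eqP; rewrite eq_le h s0.
  rewrite big1 ?st0 ?mul0r ?mulr0 // => i _.
  have := ps i; rewrite st0 mulr0 => h; have := p1_ge0 i; have := p0_ge0 i => h0 h1.
  have -> : p1 i = 0 by lra.
  have -> : p0 i = 0 by lra.
  by rewrite subrr expr0n.
(* The squared difference of the roots is at most [(p1 - p0)^2 / (p1 + p0)]. *)
apply: (@le_trans _ _ (\sum_i (2 / s t) * d t i ^+ 2)).
  apply: ler_sum => i _.
  have h1 := sqr_sqrtr (p1_ge0 i); have h0 := sqr_sqrtr (p0_ge0 i).
  move: (sqrtr_ge0 (p1 i)) (sqrtr_ge0 (p0 i)) h1 h0.
  move: (Num.sqrt (p1 i)) (Num.sqrt (p0 i)) => a b' a0 b0 h1 h0.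
  have E : d t i ^+ 2 = ((a - b') ^+ 2 * (a + b') ^+ 2) / 4.
    have := pd i; rewrite -h1 -h0 => e.
    have -> : d t i = (a ^+ 2 - b' ^+ 2) / 2 by rewrite e; field.
    by field.
  have E2 : s t = (a ^+ 2 + b' ^+ 2) / 2 by rewrite h1 h0 ps; field.
  rewrite mulrAC ler_pdivlMr // E E2.
  have := sqr_ge0 (a - b'); have := mulr_ge0 a0 b0; nra.
rewrite -mulr_sumr; have := level_one st; rewrite -/(s t) => h.
have h2 : 0 <= 2 / s t by rewrite divr_ge0 // ltW.
apply: le_trans (ler_wpM2l h2 h) _; rewrite le_eqVlt; apply/orP; left; apply/eqP.
by field; rewrite gt_eqF.
Qed.

End LevelOne.

(** * Hellinger distance *)

Section Hellinger.
Variables (R : realType) (P : finType).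
Implicit Types f g h : P -> R.

Lemma helC f g : hellinger f g = hellinger g f.
Proof. by apply: eq_bigr => t _; rewrite -sqrrN opprB. Qed.

Lemma hel_ge0 f g : 0 <= hellinger f g.
Proof. by apply: sumr_ge0 => t _; rewrite sqr_ge0. Qed.

Lemma hel_triangle f g h : hellinger f h <= 2 * hellinger f g + 2 * hellinger g h.
Proof.
rewrite /hellinger !mulr_sumr -big_split /=; apply: ler_sum => t _.
have := sqr_ge0 (Num.sqrt (f t) - 2 * Num.sqrt (g t) + Num.sqrt (h t)); nra.
Qed.

(** Expanding the squares leaves the total masses and the sum of [sqrt (f t * g t)]. *)
Lemma hel_cut_paste f g f' g' : (forall t, 0 <= f t) -> (forall t, 0 <= g t) ->
  (forall t, 0 <= f' t) -> (forall t, 0 <= g' t) ->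
  \sum_t f t + \sum_t g t = \sum_t f' t + \sum_t g' t ->
  (forall t, f t * g t = f' t * g' t) -> hellinger f g = hellinger f' g'.
Proof.
move=> f0 g0 f'0 g'0 sE pE.
have E (a c : P -> R) : (forall t, 0 <= a t) -> (forall t, 0 <= c t) ->
    hellinger a c = (\sum_t a t + \sum_t c t) - 2 * \sum_t Num.sqrt (a t * c t).
  move=> a0 c0; rewrite mulr_sumr -big_split -sumrB /=; apply: eq_bigr => t _.
  by rewrite sqrtrM // sqrrB !sqr_sqrtr //; ring.
rewrite !E // sE; congr (_ - 2 * _).
by apply: eq_bigr => t _; rewrite pE.
Qed.

(* A test that tells [f] from [g] is bounded by AM-GM applied to
   [|f - g| = |sqrt f - sqrt g| (sqrt f + sqrt g)]. *)
Lemma hel_test f g (C0 C1 : pred P) (n : R) : (forall t, 0 <= f t) -> (forall t, 0 <= g t) ->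
  \sum_t f t = n -> \sum_t g t = n -> (forall t, C0 t -> ~~ C1 t) ->
  \sum_(t | C0 t) f t + \sum_(t | C1 t) g t <= 7 / 6 * n + 6 * hellinger f g.
Proof.
move=> f0 g0 fn gn C.
have -> : 7 / 6 * n = \sum_t f t + 1 / 12 * (\sum_t f t + \sum_t g t).
  by rewrite fn gn; field.
rewrite big_mkcond [X in _ + X <= _]big_mkcond /= /hellinger.
rewrite -!big_split /= !mulr_sumr -!big_split /=.
apply: ler_sum => t _.
have := f0 t; have := g0 t; have := sqr_sqrtr (f0 t); have := sqr_sqrtr (g0 t).
move: (Num.sqrt (f t)) (Num.sqrt (g t)) => a b <- <- g1 f1.
have h1 := sqr_ge0 (a - b); have h2 := sqr_ge0 (a + b).
have h3 := sqr_ge0 (6 * (a - b) + (a + b) / 2).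
have h4 := sqr_ge0 (6 * (a - b) - (a + b) / 2).
case: ifP => c0; case: ifP => c1; try nra.
by have := C t c0; rewrite c1.
Qed.

End Hellinger.

Lemma ler_sum_comb (R : realType) (I : finType) (T : pred I) (f g h k l : I -> R) (c d : R) :
  (forall e, T e -> f e + g e <= c * h e + d * (k e + l e)) ->
  \sum_(e | T e) f e + \sum_(e | T e) g e <=
    c * (\sum_(e | T e) h e) + d * (\sum_(e | T e) k e + \sum_(e | T e) l e).
Proof. by move=> H; rewrite -!big_split !mulr_sumr -!big_split; apply: ler_sum. Qed.

(** * Indistinguishable common elements *)

Section PairBound.
Variables (R : realType) (m : nat) (K : finType) (beta : K -> bool) (kappa : nat).
Hypothesis kappaE : forall j, #|[pred i | beta i != beta j]| = kappa.
Variable P : finType.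
Local Notation coord := ('I_m * K)%type.
Local Notation word := {ffun coord -> bool}.
Local Notation sel := {ffun 'I_m -> K}.
Local Notation N := ((2 ^ #|{: coord}|)%:R : R).
Variables (tr : word -> word -> P) (cA cB : P -> pred word) (cl : P -> 'I_m -> option bool).
Hypothesis trP : forall x y t, (tr x y == t) = cA t x && cB t y.
Implicit Types (J : sel) (D z x y : word) (b : 'I_m) (i j : K) (u v : bool * bool) (t : P).

(* In each block [b] both inputs contain [J b]; any other coordinate [w] is owned by
   Alice if [D w] and by Bob otherwise, and its owner holds the free bit [z w]. *)
Definition base_input J D z : word := [ffun w => (w.2 == J w.1) || (D w && z w)].
Definition complement D : word := [ffun w => ~~ D w].
Definition override b j i u x : word :=
  [ffun w => if w == (b, j) then u.1 else if w == (b, i) then u.2 else x w].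
Definition input b j i u J D z := override b j i u (base_input J D z).
(* The number of ways to reach the transcript [t] when the bits of [j] and [i] in
   block [b] are forced to [u] for Alice and to [v] for Bob. *)
Definition cnt b j i u v J D t : R :=
  \sum_(z : word) (tr (input b j i u J D z) (input b j i v J (complement D) z) == t)%:R.
Definition upd J b i : sel := [ffun b' => if b' == b then i else J b'].

Lemma cnt_ge0 b j i u v J D t : 0 <= cnt b j i u v J D t.
Proof. exact: sumr_ge0. Qed.

Lemma cnt_sum b j i u v J D : \sum_t cnt b j i u v J D t = N.
Proof.
rewrite exchange_big /= -sum_word1; apply: eq_bigr => z _.
rewrite (bigD1 (tr (input b j i u J D z) (input b j i v J (complement D) z))) //= eqxx.
by rewrite big1 ?addr0 // => t /negbTE; rewrite eq_sym => ->.
Qed.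

(** Exchanging the coordinates outside [D] between two words is an involution on pairs of words that
    turns the product of sums into a joint sum. *)
Lemma sum_indep D (f g : pred word) :
  (forall z z', (forall w, D w -> z w = z' w) -> f z = f z') ->
  (forall z z', (forall w, ~~ D w -> z w = z' w) -> g z = g z') ->
  (\sum_(z : word) (f z && g z)%:R) * N =
    (\sum_(z : word) (f z)%:R) * (\sum_(z : word) (g z)%:R) :> R.
Proof.
move=> fD gD.
pose mix (z z' : word) : word := [ffun w => if D w then z w else z' w].
rewrite big_distrlr /= pair_big /=.
rewrite (eq_bigr (fun w : word * word => (f (mix w.1 w.2) && g (mix w.1 w.2))%:R)); last first.
  move=> [z z'] _ /=; rewrite -natrM mulnb; congr (_ && _)%:R.
    by apply: fD => w Dw; rewrite ffunE Dw.
  by apply: gD => w /negbTE Dw; rewrite ffunE Dw.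
rewrite (reindex (fun w : word * word => (mix w.1 w.2, mix w.2 w.1))) /=; last first.
  exists (fun w : word * word => (mix w.1 w.2, mix w.2 w.1)) => -[z z'] _ /=;
  by congr (_, _); apply/ffunP => w; rewrite !ffunE; case: (D w).
rewrite (eq_bigr (fun w : word * word => (f w.1 && g w.1)%:R * 1)); last first.
  move=> [z z'] _ /=; rewrite mulr1.
  have -> : mix (mix z z') (mix z' z) = z by apply/ffunP => w; rewrite !ffunE; case: (D w).
  by [].
rewrite -(pair_big predT predT (fun z _ => (f z && g z)%:R * 1)) /=.
by rewrite -big_distrlr /= sum_word1.
Qed.

Lemma inp_dep b j i u J D z z' : (forall w, D w -> z w = z' w) ->
  input b j i u J D z = input b j i u J D z'.
Proof.
move=> H; apply/ffunP => w; rewrite !ffunE.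
by case: ifP => // _; case: ifP => // _; case Dw: (D w); rewrite //= H.
Qed.

(** Alice's input uses the free bits in [D] and Bob's the ones outside, so the two sides of the
    rectangle are independent. *)
Lemma cnt_prod b j i u v J D t : cnt b j i u v J D t * N =
  (\sum_(z : word) (cA t (input b j i u J D z))%:R) *
  (\sum_(z : word) (cB t (input b j i v J (complement D) z))%:R).
Proof.
rewrite -(sum_indep (D := D)).
- by congr (_ * _); apply: eq_bigr => z _; rewrite trP.
- by move=> z z' H; rewrite (inp_dep b j i u J H).
- by move=> z z' H; rewrite (inp_dep b j i v J (z' := z')) // => w; rewrite ffunE; apply: H.
Qed.

Lemma cnt_cut_paste b j i u v u' v' J D t :
  cnt b j i u v J D t * cnt b j i u' v' J D t =
  cnt b j i u v' J D t * cnt b j i u' v J D t.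
Proof.
have N0 : N != 0 by rewrite pnatr_eq0 -lt0n expn_gt0.
apply: (mulIf N0); apply: (mulIf N0).
have E (a c : R) : a * c * N * N = (a * N) * (c * N) by ring.
by rewrite !E !cnt_prod; ring.
Qed.

Lemma hel_cnt b j i u v u' v' J D :
  hellinger (cnt b j i u v J D) (cnt b j i u' v' J D) =
  hellinger (cnt b j i u v' J D) (cnt b j i u' v J D).
Proof.
apply: hel_cut_paste; try by move=> t; apply: cnt_ge0.
  by rewrite !cnt_sum.
by move=> t; apply: cnt_cut_paste.
Qed.

Lemma cnt_setb b j i u v J D c : cnt b j i u v J (setb D (b, i) c) = cnt b j i u v J D.
Proof.
apply/funext => t; apply: eq_bigr => z _; congr (tr _ _ == t)%:R;
by apply/ffunP => w; rewrite !ffunE; case: (w == (b, j)) => //; case: (w == (b, i)).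
Qed.

Lemma cnt_alice b i J D c t : i != J b -> D (b, i) ->
  \sum_(z : word) (tr (base_input J D (setb z (b, i) c))
                      (base_input J (complement D) (setb z (b, i) c)) == t)%:R =
  cnt b (J b) i (true, c) (true, false) J D t.
Proof.
move=> iJ Db; apply: eq_bigr => z _; congr (tr _ _ == t)%:R;
  apply/ffunP => w; rewrite !ffunE;
  case: (w =P (b, J b)) => [->|_]; rewrite /= ?eqxx //;
  by case: (w =P (b, i)) => [->|//]; rewrite /= (negbTE iJ) Db.
Qed.

Lemma cnt_bob b i J D c t : i != J b -> ~~ D (b, i) ->
  \sum_(z : word) (tr (base_input J D (setb z (b, i) c))
                      (base_input J (complement D) (setb z (b, i) c)) == t)%:R =
  cnt b (J b) i (true, false) (true, c) J D t.
Proof.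
move=> iJ /negbTE Db; apply: eq_bigr => z _; congr (tr _ _ == t)%:R;
  apply/ffunP => w; rewrite !ffunE;
  case: (w =P (b, J b)) => [->|_]; rewrite /= ?eqxx //;
  by case: (w =P (b, i)) => [->|//]; rewrite /= (negbTE iJ) Db.
Qed.

Definition sw u := (u.2, u.1).

(** Both [J b] and [i] carry forced bits, so either may be regarded as the selected element of block
    [b]. *)
Lemma inp_swap b i u J D z : i != J b ->
  input b (J b) i u J D z = input b i (J b) (sw u) (upd J b i) D z.
Proof.
move=> iJ; apply/ffunP => -[b' k]; rewrite !ffunE /= !xpair_eqE.
have [->|] := eqVneq b' b => //=; rewrite ?eqxx //=.
have [->|kJ] := eqVneq k (J b); first by rewrite eq_sym (negbTE iJ).
by case: eqVneq.
Qed.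

Lemma cnt_swap b i u v J D : i != J b ->
  cnt b (J b) i u v J D = cnt b i (J b) (sw u) (sw v) (upd J b i) D.
Proof.
by move=> iJ; apply/funext => t; apply: eq_bigr => z _; rewrite !inp_swap.
Qed.

(** How far the transcript moves when [i] is added to the set of Alice, or of Bob, while [J b] stays
    the only common element of the block. *)
Definition dist b J i D :=
  hellinger (cnt b (J b) i (true, true) (true, false) J D)
            (cnt b (J b) i (true, false) (true, false) J D) +
  hellinger (cnt b (J b) i (true, false) (true, true) J D)
            (cnt b (J b) i (true, false) (true, false) J D).

(** Neither term of [dist] depends on the owner of [(b, i)]. So the first is summed over the [D]
    that give this coordinate to Alice and the second over the others, each doubled; then
    [info_bound] applies for every [D]. *)
Lemma sum_dist_le J : \sum_D \sum_b \sum_(i | i != J b) dist b J i D <=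
  \sum_(D : word) 32 * (N * ln #|P|%:R).
Proof.
pose H D w := hellinger
  (fun t => \sum_(z : word) (tr (base_input J D (setb z w true))
                                (base_input J (complement D) (setb z w true)) == t)%:R : R)
  (fun t => \sum_(z : word) (tr (base_input J D (setb z w false))
                                (base_input J (complement D) (setb z w false)) == t)%:R : R).
apply: (@le_trans _ _ (\sum_D \sum_b \sum_(i | i != J b) 2 * H D (b, i))).
  rewrite exchange_big [leRHS]exchange_big; apply: ler_sum => b _.
  rewrite exchange_big [leRHS]exchange_big; apply: ler_sum => i iJ /=.
  rewrite -mulr_sumr [\sum_D H _ _](bigID (fun D : word => D (b, i) == true)) mulrDr /=.
  rewrite /dist big_split /=; apply: lerD.
    rewrite (eq_bigr (fun D : word => hellinger
      (cnt b (J b) i (true, true) (true, false) J (setb D (b, i) true))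
      (cnt b (J b) i (true, false) (true, false) J (setb D (b, i) true)))); last first.
      by move=> D _; rewrite !cnt_setb.
    rewrite (sum_setb (fun D => hellinger (cnt b (J b) i (true, true) (true, false) J D)
      (cnt b (J b) i (true, false) (true, false) J D))) mulr_natl lerMn2r /=.
    rewrite le_eqVlt; apply/orP; left; apply/eqP; apply: eq_bigr => D /eqP Db.
    by rewrite /H /hellinger; apply: eq_bigr => t _; rewrite !cnt_alice ?Db.
  rewrite (eq_bigr (fun D : word => hellinger
    (cnt b (J b) i (true, false) (true, true) J (setb D (b, i) false))
    (cnt b (J b) i (true, false) (true, false) J (setb D (b, i) false)))); last first.
    by move=> D _; rewrite !cnt_setb.
  rewrite (sum_setb (fun D => hellinger (cnt b (J b) i (true, false) (true, true) J D)
    (cnt b (J b) i (true, false) (true, false) J D))) mulr_natl lerMn2r /=.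
  rewrite le_eqVlt; apply/orP; left; apply/eqP; apply: eq_big => D.
    by case: (D _).
  move=> /eqP Db; rewrite /H /hellinger; apply: eq_bigr => t _; rewrite !cnt_bob ?Db //.
apply: ler_sum => D _.
apply: (@le_trans _ _ (2 * \sum_w H D w)).
  rewrite -(pair_big predT predT (fun b i => H D (b, i))) /= mulr_sumr.
  apply: ler_sum => b _; rewrite -mulr_sumr ler_wpM2l //.
  rewrite [leRHS](bigID (fun i => i != J b)) /= lerDl; apply: sumr_ge0 => i _.
  exact: hel_ge0.
have := info_bound R (fun z => tr (base_input J D z) (base_input J (complement D) z)).
rewrite -[leLHS]/(\sum_w H D w); lra.
Qed.

Definition success b J i D : R :=
  \sum_(t | cl t b == Some (beta (J b))) cnt b (J b) i (true, false) (true, false) J D t.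

Lemma updb J b i : upd J b i b = i.
Proof. by rewrite ffunE eqxx. Qed.

Lemma upd_upd J b i : upd (upd J b i) b (J b) = J.
Proof. by apply/ffunP => b'; rewrite !ffunE; case: eqP => // ->. Qed.

(** By cut and paste, the transcripts for the common element [J b], and those for [i], are both
    close to the ones where both players hold both elements. The answers required differ, so
    [hel_test] applies; 24 is its 6 times 2 for each of two triangle inequalities. *)
Lemma succ_pair b J i D (J' := upd J b i) : beta i != beta (J b) ->
  success b J i D + success b J' (J b) D <=
    7 / 6 * N + 24 * (dist b J i D + dist b J' (J b) D).
Proof.
move=> bi; have iJ : i != J b by apply: contraNneq bi => ->.
have iJ' : J b != J' b by rewrite updb eq_sym.
pose c u v := cnt b (J b) i u v J D.
have cE u v : cnt b (J' b) (J b) u v J' D = c (sw u) (sw v).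
  by rewrite updb /c cnt_swap //; case: u v => [u1 u2] [v1 v2].
have -> : dist b J' (J b) D =
    hellinger (c (true, true) (false, true)) (c (false, true) (false, true)) +
    hellinger (c (false, true) (true, true)) (c (false, true) (false, true)).
  by rewrite /dist !cE.
have -> : success b J' (J b) D =
    \sum_(t | cl t b == Some (beta i)) c (false, true) (false, true) t.
  by rewrite /success cE updb.
rewrite /success /dist -/(c _ _).
have cut u v : hellinger (c u u) (c v v) <=
    2 * hellinger (c v u) (c u u) + 2 * hellinger (c u v) (c u u).
  rewrite hel_cnt -!/(c _ _); apply: le_trans (hel_triangle _ (c u u) _) _.
  by rewrite (helC (c u u) (c v u)) addrC.
have tr1 := cut (true, false) (true, true).
have tr2 := cut (false, true) (true, true).
have tr3 := hel_triangle (c (true, false) (true, false)) (c (true, true) (true, true))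
  (c (false, true) (false, true)).
rewrite (helC (c (true, true) (true, true)) (c (false, true) (false, true))) in tr3.
apply: le_trans (hel_test _ _ (cnt_sum _ _ _ _ _ _ _) (cnt_sum _ _ _ _ _ _ _) _) _.
- by move=> t; apply: cnt_ge0.
- by move=> t; apply: cnt_ge0.
- move=> t /eqP->; apply: contraNN bi => /eqP [->]; exact: eqxx.
by rewrite -!/(c _ _); lra.
Qed.

(** Exchanging [J b] and [i] is an involution of the index set. *)
Lemma sum_involution b (G : sel -> K -> R) :
  \sum_(J : sel) \sum_(i | beta i != beta (J b)) G J i =
  \sum_(J : sel) \sum_(i | beta i != beta (J b)) G (upd J b i) (J b).
Proof.
rewrite !pair_big_dep /=.
rewrite (reindex (fun w : sel * K => (upd w.1 b w.2, w.1 b))) /=; last first.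
  by exists (fun w : sel * K => (upd w.1 b w.2, w.1 b)) => -[J i] _ /=;
    rewrite upd_upd updb.
by apply: eq_bigl => -[J i] /=; rewrite updb eq_sym.
Qed.

Lemma pair_bound (k0 : K) :
  2 / 3 * (\sum_b \sum_(J : sel) \sum_(i | beta i != beta (J b)) \sum_(D : word) N) <=
    \sum_b \sum_(J : sel) \sum_(i | beta i != beta (J b)) \sum_(D : word) success b J i D ->
  (m * kappa)%:R <= 96 * 96 * ln (#|P|%:R) :> R.
Proof.
set S := leRHS => HS.
pose X := \sum_(J : sel) \sum_(D : word) \sum_b \sum_(i | i != J b) dist b J i D.
pose Q : R := #|{: sel}|%:R * #|{: word}|%:R.
have N0 : 0 < N by rewrite ltr0n expn_gt0.
have Q0 : 0 < Q.
  rewrite mulr_gt0 // ltr0n; apply/card_gt0P.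
    by exists [ffun=> k0].
  by exists [ffun=> true].
have XQ : X <= Q * (32 * (N * ln #|P|%:R)).
  apply: (@le_trans _ _ (\sum_(J : sel) \sum_(D : word) 32 * (N * ln #|P|%:R))).
    by apply: ler_sum => J _; apply: sum_dist_le.
  by rewrite !sumr_const -mulrnA -[leLHS]mulr_natl natrM /Q [X in X * _]mulrC.
pose Y := \sum_b \sum_(J : sel) \sum_(i | beta i != beta (J b)) \sum_(D : word) dist b J i D.
have YX : Y <= X.
  rewrite /Y exchange_big /X; apply: ler_sum => J _ /=.
  rewrite [leRHS]exchange_big; apply: ler_sum => b _ /=.
  rewrite [leRHS]exchange_big /= big_mkcond [leRHS]big_mkcond /=; apply: ler_sum => i _.
  have [->|iJ] := eqVneq i (J b); first by rewrite eqxx.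
  case: ifP => // _; apply: sumr_ge0 => D _; rewrite addr_ge0 // hel_ge0 //.
pose M := \sum_b \sum_(J : sel) \sum_(i | beta i != beta (J b)) \sum_(D : word) N.
have ME : M = (m * kappa)%:R * Q * N.
  transitivity (\sum_(b < m) \sum_(J : sel) #|{: word}|%:R * N * kappa%:R).
    apply: eq_bigr => b _; apply: eq_bigr => J _; rewrite !sumr_const.
    rewrite -[X in _ *+ X = _]/(#|[pred i | beta i != beta (J b)]|) kappaE.
    by rewrite -mulrnA -[LHS]mulr_natl natrM; ring.
  by rewrite !sumr_const card_ord -mulrnA -[LHS]mulr_natl !natrM /Q; ring.
have inv (F : 'I_m -> sel -> K -> word -> R) :
    \sum_b \sum_(J : sel) \sum_(i | beta i != beta (J b)) \sum_(D : word) F b J i D =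
    \sum_b \sum_(J : sel) \sum_(i | beta i != beta (J b)) \sum_(D : word)
      F b (upd J b i) (J b) D.
  by apply: eq_bigr => b _; rewrite (sum_involution b (fun J i => \sum_(D : word) F b J i D)).
have S2 : S + S <= 7 / 6 * M + 24 * (Y + Y).
  rewrite [X in S + X](inv (fun b J i D => success b J i D)).
  rewrite [X in 24 * (Y + X)](inv (fun b J i D => dist b J i D)).
  apply: ler_sum_comb => b _ /=; apply: ler_sum_comb => J _ /=.
  apply: ler_sum_comb => i bi /=; apply: ler_sum_comb => D _ /=.
  exact: succ_pair.
rewrite -/M ME in HS; rewrite ME in S2.
have {}XQ := le_trans YX XQ.
(* Success 2/3 gives [M / 6 <= 48 * Y], and [288 * 32 = 96 * 96]. *)
have : (m * kappa)%:R * (Q * N) <= 96 * 96 * ln #|P|%:R * (Q * N) by lra.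
by rewrite ler_pM2r // mulr_gt0.
Qed.

End PairBound.

(** * Space bounds *)

Section Averaging.
Variables (R : realType) (W : finType) (p : W -> R).
Hypotheses (p0 : forall w, 0 <= p w) (p1 : \sum_w p w = 1).

Lemma average_sum (I : finType) (T : pred I) (c : I -> R) (F : I -> W -> R) :
  (forall b, T b -> c b <= \sum_w p w * F b w) ->
  \sum_(b | T b) c b <= \sum_w p w * \sum_(b | T b) F b w.
Proof.
move=> H; under [leRHS]eq_bigr do rewrite mulr_sumr.
by rewrite exchange_big /=; apply: ler_sum.
Qed.

Lemma average_pick (c : R) (F : W -> R) :
  c <= \sum_w p w * F w -> exists w, c <= F w.
Proof.
move=> H; apply/not_existsP => N.
have pos w : 0 <= p w * (c - F w).
  by rewrite mulr_ge0 // subr_ge0 leNgt; apply/negP => /ltW /N.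
have : \sum_w p w * (c - F w) <= 0.
  under eq_bigr do rewrite mulrBr.
  by rewrite sumrB -mulr_suml p1 mul1r subr_le0.
move=> le0; have : \sum_w p w * (c - F w) == 0 by rewrite eq_le le0 sumr_ge0.
rewrite psumr_eq0 // => /allP z.
have : \sum_w p w = 0.
  apply: big1 => w _; have := z w (mem_index_enum w).
  rewrite mulf_eq0 => /orP[/eqP//|]; rewrite subr_eq0 => /eqP E.
  by case: (N w); rewrite E.
by rewrite p1; apply/eqP/oner_neq0.
Qed.

End Averaging.

(** * Algorithms without memory *)

Section ZeroSpace.
Variables (n : nat) (A : streaming_alg n 0) (st : seq ('I_n * 'I_n)).

Lemma run_passE mem o : run_pass A st (mem, o) =
  ((run_pass A st (mem, [::])).1, o ++ (run_pass A st (mem, [::])).2).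
Proof.
rewrite /run_pass -!/(feed A st _) feedE.
by case: (feed A st (mem, [::])) => mem' o'; rewrite /emit /= catA.
Qed.

(* Without memory every pass writes the same sequence, which is empty if a tape
   without repetition holds at least two copies of it. *)
Lemma output_one_pass p : (0 < p)%N -> uniq (output A p st) ->
  output A p st = output A 1 st.
Proof.
case: p => [|[|p]] // _.
have mem1 (mem mem' : 0.-tuple bool) : mem = mem' by rewrite (tuple0 mem) (tuple0 mem').
pose w := (run_pass A st (alg_init A, [::])).2.
have iterE k : iter k (run_pass A st) (alg_init A, [::]) = (alg_init A, flatten (nseq k w)).
  elim: k => // k IH; rewrite iterS IH run_passE -/w; congr pair; first exact: mem1.
  have -> : flatten (nseq k w) ++ w = flatten (nseq (k + 1)%N w).
    by rewrite nseqD flatten_cat /= cats0.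
  by rewrite addn1.
rewrite /output !iterE /=; case: w {iterE} => [|v w'] /=.
  by have -> : flatten (nseq p [::]) = [::] :> seq 'I_n by elim: p.
by rewrite !mem_cat mem_head !orbT.
Qed.

End ZeroSpace.

Definition chain_input (m : nat) (T : Type) (d : T) (f : 'I_m -> T) (b : nat) : T :=
  if insub b is Some i then f i else d.

Lemma chain_input_ord m T (d : T) (f : 'I_m -> T) (b : 'I_m) : chain_input d f b = f b.
Proof. by rewrite /chain_input valK. Qed.


Lemma card_transcript_le (s p : nat) :
  (#|transcript (s.-tuple bool) p| <= 2 ^ (2 * p * (s + 2)))%N.
Proof.
have -> : (2 * p * (s + 2) = (s + 2) * 2 * p)%N by lia.
rewrite card_transcript !expnM; have [->|p0] := posnP p; first by rewrite !expn0.
by rewrite !leq_exp2r // expnD leq_mul2l orbT.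
Qed.

Lemma inp_special m (K : finType) (b b' : 'I_m) (J : {ffun 'I_m -> K}) i D z :
  i != J b -> input b (J b) i (true, false) J D z (b', J b').
Proof.
rewrite /input /override /base_input !ffunE /= !xpair_eqE => iJ.
by have [->|_] := eqVneq b' b; rewrite /= eqxx.
Qed.

(** Each free bit enters the input of its owner only, so nothing but the forced element is
    common. *)
Lemma inp_inter m (K : finType) (b b' : 'I_m) (J : {ffun 'I_m -> K}) i D z e :
  input b (J b) i (true, false) J D z (b', e) ->
  input b (J b) i (true, false) J (complement D) z (b', e) -> e = J b'.
Proof.
rewrite /input /override /base_input !ffunE /= !xpair_eqE.
have [->|_] := eqVneq b' b; rewrite /=.
  by case: eqP => // _; case: eqP => //= _; case: (D _).
by case: eqP => //= _; case: (D _).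
Qed.

Definition at_block m (K : Type) (x : 'I_m * K -> bool) (b : nat) (e : K) : bool :=
  chain_input false (fun i => x (i, e)) b.

Lemma at_block_ord m (K : Type) (x : 'I_m * K -> bool) (b : 'I_m) e :
  at_block x b e = x (b, e).
Proof. exact: chain_input_ord. Qed.

Section Space.
Variables (R : realType) (n' s p alpha : nat) (cyc : bool).
Local Notation n := n'.+1.
Variable A : rand_streaming_alg R n s.
Hypothesis solA : solves A p alpha (@sol_of cyc n).

Section Success.
Variables (q m : nat) (bp : rel nat) (X Y : Type).
Variables (gA : X -> nat -> rel nat) (gB : Y -> nat -> rel nat).
Hypothesis irr : forall x y b u, blocks bp gA gB x y b u u = false.

Definition correct (w : seed A) x y :=
  chain_sol q m cyc (irr x y)
   (output (alg_of_seed w) p (streamA n' q m cyc bp gA x ++ streamB n' q m cyc bp gB y)).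

Lemma correct_prob x y :
  (0 < q)%N -> m = (n' %/ q)%N -> (0 < m)%N -> (0 < alpha)%N ->
  (forall b u, (b < m)%N -> uniq u -> all (gtn q) u ->
    {in u &, forall v w, ~~ blocks bp gA gB x y b v w} -> (size u <= alpha)%N) ->
  (forall b, (b < m)%N -> exists u, gadget_ham (blocks bp gA gB x y b) q u) ->
  2 / 3 <= \sum_w seed_prob w * (correct w x y)%:R.
Proof.
move=> q0 mE m0 a0 ind ex.
have I := chain_independence cyc q0 mE m0 (irr x y) a0 ind.
have [t Ht] := chain_sol_exists cyc q0 mE m0 (irr x y) ex.
have := solA I (ex_intro _ t Ht) (arrival_stream n' q m cyc irr x y).
rewrite big_mkcond /= => /le_trans; apply; apply: ler_sum => w _.
rewrite (_ : (if _ then _ else _) = if correct w x y then seed_prob w else 0) //.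
by case: (correct w x y); rewrite ?mulr1 ?mulr0.
Qed.
End Success.

(** Some seed is right on at least 2/3 of all pairs of words, while [xor_bound] allows few pairs per
    transcript. *)
Lemma xor_space m : (4 <= n')%N -> (2 <= alpha)%N -> m = (n' %/ 4)%N ->
  (m <= m./2 + 2 * p * (s + 2) + 2)%N.
Proof.
move=> n4 a2 mE; have m0 : (0 < m)%N by rewrite mE divn_gt0.
pose word := {ffun 'I_m -> bool}.
pose gA (x : word) b := xor_alice (chain_input false x b).
pose gB (y : word) b := xor_jmp (chain_input false y b).
have irr x y b u : blocks xor_bob gA gB x y b u u = false by apply: xor_irr.
pose ok w (e : word * word) := correct 4 m irr w e.1 e.2.
have [w Hw] : exists w, 2 / 3 * (2 ^ m * 2 ^ m)%:R <= \sum_e (ok w e)%:R :> R.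
  apply: (average_pick (@seed_prob_ge0 _ _ _ A) (seed_prob_sum1 A)).
  have -> : 2 / 3 * (2 ^ m * 2 ^ m)%:R = \sum_(e : word * word) (2 / 3) :> R.
    by rewrite sumr_const card_prod card_ffun card_bool card_ord mulr_natr.
  apply: average_sum => -[x y] _; apply: correct_prob => //; first exact: ltnW.
    by move=> b u bm uu u4 ind; apply: leq_trans a2; apply: xor_independent ind.
  by move=> b bm; apply: xor_exists.
pose rA := turnA (alg_of_seed w) (streamA n' 4 m cyc xor_bob gA).
pose rB := turnB (alg_of_seed w) (streamB n' 4 m cyc xor_bob gB).
pose tr := transcript_of (alg_init (alg_of_seed w)) rA rB p (@chain_typ n' 4 m xor_typ).
pose ca t x (b : 'I_m) :=
  run_claimA 4 m cyc xor_bob gA (alg_of_seed w) (p := p) xor_typ xor_dec t x b.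
pose cb t y (b : 'I_m) :=
  run_claimB 4 m cyc xor_bob gB (alg_of_seed w) (p := p) xor_typ xor_dec t y b.
have B := xor_bound tr ca cb.
have : 2 / 3 * (2 ^ m * 2 ^ m)%:R <=
    (#|transcript (s.-tuple bool) p| * (2 * 2 ^ (m + m./2)))%:R :> R.
  apply: le_trans Hw _; rewrite -natr_sum ler_nat; apply: leq_trans B.
  rewrite -sum1_card big_mkcond /= [leqRHS]big_mkcond /=; apply: leq_sum => -[x y] _.
  case: ifP => [|/negP N]; first by case: (ok _ _).
  case: (boolP (ok w (x, y))) => // okw; case: N; apply/forallP => b /=.
  apply: (run_claims (isT : 0 < 4)%N mE m0 (ltn_ord b) okw) => l u.
  have := @xor_claims (x b) (y b) l u.
  by rewrite /blocks /gA /gB !chain_input_ord.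
have := card_transcript_le s p; move: #|_| => c cle.
rewrite -[2 / 3]/(2%:R / 3%:R) mulrAC ler_pdivrMr ?ltr0n // -!natrM ler_nat => H.
(* Rounding 3 up to 4 leaves powers of 2, whose exponents are compared. *)
have {}H : (2 * (2 ^ m * 2 ^ m) <= 2 ^ (2 * p * (s + 2)) * (2 * 2 ^ (m + m./2)) * 4)%N.
  by apply: leq_trans H _; apply: leq_mul => //; rewrite leq_mul2r cle orbT.
rewrite -expnD -{1}(expn1 2) -expnD in H.
rewrite mulnAC -(expnS 2 (m + m./2)) -[4%N]/(2 ^ 2)%N -!expnD leq_exp2l // in H.
lia.
Qed.

Lemma card_flip k (j : entry k) : #|[pred i : entry k | i.2 != j.2]| = (k * k)%N.
Proof.
pose f (a : 'I_k * 'I_k) : entry k := (a, ~~ j.2).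
have fi : injective f by move=> a b [].
have := card_codom fi; rewrite card_prod !card_ord => <-; apply: eq_card => -[a c].
rewrite inE; apply/idP/codomP => [/= ca|[a' [_ ->]] /=]; last by case: (j.2).
by exists a; congr pair; case: c ca; case: (j.2).
Qed.

Lemma mat_space k m : (0 < k)%N -> (9 * k <= n')%N -> (9 * k <= alpha)%N ->
  m = (n' %/ (9 * k))%N ->
  (m * (k * k))%:R <= 96 * 96 * (2 * p * (s + 2) + 4 * m)%:R :> R.
Proof.
move=> k0 kn ka mE.
have q0 : (0 < 9 * k)%N by rewrite muln_gt0.
have m0 : (0 < m)%N by rewrite mE divn_gt0.
pose word := {ffun 'I_m * entry k -> bool}.
pose sel := {ffun 'I_m -> entry k}.
pose gA (x : word) b := mat_alice (at_block x b).
pose gB (y : word) b := jmpB (at_block y b).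
have irr x y b u : blocks (mat_bob) gA gB x y b u u = false by apply: mat_irr.
pose X (b : 'I_m) (J : sel) (i : entry k) (D z : word) := input b (J b) i (true, false) J D z.
pose ok w b J i (D z : word) :=
  correct (9 * k) m irr w (X b J i D z) (X b J i (complement D) z).
have neJ b (J : sel) (i : entry k) : i.2 != (J b).2 -> i != J b.
  by apply: contraNneq => ->.
have inter b (J : sel) i (D z : word) e : at_block (X b J i D z) b e ->
    at_block (X b J i (complement D) z) b e -> e.2 = (J b).2.
  move=> h1 h2; have x1 := etrans (esym (at_block_ord (X b J i D z) b e)) h1.
  have y1 := etrans (esym (at_block_ord (X b J i (complement D) z) b e)) h2.
  exact: (congr1 snd (inp_inter x1 y1)).
have [w Hw] : exists w, 2 / 3 * (\sum_b \sum_(J : sel) \sum_(i : entry k | i.2 != (J b).2)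
      \sum_(D : word) (2 ^ #|{: 'I_m * entry k}|)%:R) <=
    \sum_b \sum_(J : sel) \sum_(i : entry k | i.2 != (J b).2) \sum_(D : word)
      \sum_z (ok w b J i D z)%:R :> R.
  apply: (average_pick (@seed_prob_ge0 _ _ _ A) (seed_prob_sum1 A)).
  rewrite mulr_sumr; apply: average_sum => b _.
  rewrite mulr_sumr; apply: average_sum => J _.
  rewrite mulr_sumr; apply: average_sum => i bi.
  rewrite mulr_sumr; apply: average_sum => D _.
  rewrite -sum_word1 mulr_sumr; apply: average_sum => z _; rewrite mulr1.
  apply: correct_prob => //; first exact: leq_trans ka.
    move=> b' u _ uu /allP uq _; apply: leq_trans ka.
    rewrite -[X in (_ <= X)%N](size_iota 0); apply: uniq_leq_size => // v /uq.
    by rewrite mem_iota.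
  move=> b' b'm; apply: (@mat_exists _ _ _ (J (Ordinal b'm))).
    by rewrite (at_block_ord _ (Ordinal b'm)); apply: inp_special; apply: neJ.
  by rewrite (at_block_ord _ (Ordinal b'm)); apply: inp_special; apply: neJ.
pose aw := alg_of_seed w.
pose rA := turnA aw (streamA n' (9 * k) m cyc mat_bob gA).
pose rB := turnB aw (streamB n' (9 * k) m cyc mat_bob gB).
pose typ := @chain_typ n' (9 * k) m (mat_typ k).
pose tr0 := transcript_of (alg_init aw) rA rB p typ.
pose claim := {ffun 'I_m -> option bool}.
pose ca t x : claim := [ffun b : 'I_m =>
  run_claimA (9 * k) m cyc mat_bob gA aw (p := p) (mat_typ k) (mat_dec k) t x b].
pose cb t y : claim := [ffun b : 'I_m =>
  run_claimB (9 * k) m cyc mat_bob gB aw (p := p) (mat_typ k) (mat_dec k) t y b].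
(* Appending the claims of both players makes the answer a function of the transcript, at the cost
   of a factor [3^(2 m) <= 2^(4 m)]. *)
pose P : finType := (transcript (s.-tuple bool) p * claim * claim)%type.
pose tr x y : P := (tr0 x y, ca (tr0 x y) x, cb (tr0 x y) y).
pose cA (t : P) x := consA (alg_init aw) rA typ t.1.1 x && (ca t.1.1 x == t.1.2).
pose cB (t : P) y := consB (alg_init aw) rB typ t.1.1 y && (cb t.1.1 y == t.2).
have trP x y (t : P) : (tr x y == t) = cA t x && cB t y.
  case: t => [[t u] v]; rewrite /cA /cB /= /tr !xpair_eqE andbACA -transP.
  by case: eqP => //= ->; rewrite ?andbA.
pose cl (t : P) (b : 'I_m) := if t.1.2 b is Some c then Some c else t.2 b.
have := @pair_bound R m (entry k) snd (k * k) (@card_flip k) P tr cA cB cl trP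
  (Ordinal k0, Ordinal k0, true).
have cl_ok b (J : sel) i (D z : word) : i.2 != (J b).2 -> ok w b J i D z ->
    cl (tr (X b J i D z) (X b J i (complement D) z)) b == Some (J b).2.
  move=> bi okw.
  have H : one_claims (ca (tr0 (X b J i D z) (X b J i (complement D) z)) (X b J i D z) b)
      (cb (tr0 (X b J i D z) (X b J i (complement D) z)) (X b J i (complement D) z) b) (J b).2.
    rewrite !ffunE; apply: (run_claims q0 mE m0 (ltn_ord b) okw) => l u.
    exact: mat_claims k0 (inter b J i D z).
  by move: H; rewrite /cl /tr /= /one_claims; case/orP=> /andP[/eqP-> /eqP E] /=; rewrite ?E.
have succE b (J : sel) i (D : word) : i.2 != (J b).2 ->
    \sum_(z : word) (ok w b J i D z)%:R <= success R snd tr cl b J i D.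
  move=> bi; rewrite /success /cnt exchange_big /=; apply: ler_sum => z _.
  case: (boolP (ok w b J i D z)) => [/(cl_ok _ _ _ _ _ bi) c|_]; last exact: sumr_ge0.
  rewrite (bigD1 (tr (X b J i D z) (X b J i (complement D) z))) //= eqxx lerDl.
  exact: sumr_ge0.
move=> /(_ _)/le_trans; apply.
  apply: le_trans Hw _; apply: ler_sum => b _; apply: ler_sum => J _.
  by apply: ler_sum => i bi; apply: ler_sum => D _; apply: succE.
rewrite ler_pM2l ?mulr_gt0 //.
have Pc : (#|P| <= 2 ^ (2 * p * (s + 2) + 4 * m))%N.
  rewrite !card_prod card_ffun card_option card_bool card_ord expnD -mulnA.
  rewrite leq_mul ?card_transcript_le //.
  by rewrite -expnMn expnM leq_exp2r.
have P0 : (0 < #|P|)%N by apply/card_gt0P; exists (tr [ffun=> false] [ffun=> false]).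
apply: (@le_trans _ _ (ln ((2 ^ (2 * p * (s + 2) + 4 * m))%:R : R))).
  by rewrite ler_ln ?posrE ?ltr0n ?expn_gt0 // ler_nat.
rewrite natrX lnXn // -[leLHS]mulr_natr -[leRHS]mul1r; apply: ler_wpM2r => //.
(* [ln 2 <= 1], because [2 <= expR 1]. *)
rewrite -[leRHS](@expRK R) ler_ln ?posrE ?expR_gt0 //.
by have := expR_ge1Dx (1 : R); lra.
Qed.

End Space.

Lemma sol_of_uniq cyc n (G : digraph n) t : sol_of cyc G t -> uniq t.
Proof. by rewrite /sol_of; case: cyc => /and3P[]. Qed.

(** Solutions have no repetition, so [output_one_pass] applies. This settles [s = 0], where
    [p * (s + 2)] is not of order [p * s]. *)
Lemma solves_one_pass (R : realType) n p alpha cyc (A : rand_streaming_alg R n 0) :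
  (0 < p)%N -> solves A p alpha (@sol_of cyc n) -> solves A 1 alpha (@sol_of cyc n).
Proof.
move=> p0 H G indG exG st stG; apply: le_trans (H G indG exG st stG) _.
rewrite big_mkcond [leRHS]big_mkcond /=; apply: ler_sum => w _.
case: ifP => [ok|_]; last by case: ifP => // _; apply: seed_prob_ge0.
by rewrite -(output_one_pass p0 (sol_of_uniq ok)) ok.
Qed.

(* The crossover between the two gadgets is at [alpha = 18 * 272], where
   [k ^ 2 >= 2 * 4 * 96 ^ 2] for [k = alpha %/ 18]. *)
Lemma space_bound (R : realType) n' s p alpha cyc (A : rand_streaming_alg R n'.+1 s) :
  solves A p alpha (@sol_of cyc n'.+1) -> (4 <= n')%N -> (2 <= alpha <= n'.+1)%N ->
  (alpha * n'.+1)%:R <= 342 * (4 * 96 * 96) * (p * (s + 2))%:R + 24 * (18 * 272) :> R.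
Proof.
move=> solA n4 /andP[a2 an].
have [small|large] := ltnP alpha (18 * 272).
  have := xor_space solA n4 a2 erefl; set m := (n' %/ 4)%N => H.
  have : (alpha * n'.+1 <= 18 * 272 * (16 * (p * (s + 2)) + 24))%N.
    apply: leq_mul; first exact: ltnW.
    lia.
  rewrite -(ler_nat R) => /le_trans; apply; rewrite !natrM natrD !natrM.
  have := ler0n R p; have := ler0n R (s + 2); nra.
(* A block has [9 * k] vertices, at most half of [alpha]; so one fits even for [alpha = n'.+1]. *)
pose k := (alpha %/ 18)%N.
have k272 : (272 <= k)%N by rewrite leq_divRL // mulnC.
have ak : (18 * k <= alpha)%N by rewrite mulnC leq_divM.
have q0 : (0 < 9 * k)%N by lia.
have [h1 h2 h3] : [/\ (0 < k)%N, (9 * k <= n')%N & (9 * k <= alpha)%N] by split; lia.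
have := mat_space solA h1 h2 h3 erefl; set m := (n' %/ (9 * k))%N => H.
have m0 : (0 < m)%N by rewrite divn_gt0.
have nm : (n'.+1 <= 18 * k * m)%N.
  have nlt : (n' < m.+1 * (9 * k))%N by rewrite -ltn_divLR.
  have : (m.+1 * (9 * k) <= (2 * m) * (9 * k))%N by rewrite leq_mul2r; lia.
  lia.
have a19 : (alpha <= 19 * k)%N.
  have alt : (alpha < k.+1 * 18)%N by rewrite -ltn_divLR.
  lia.
have an2 : (alpha * n'.+1 <= 342 * (m * (k * k)))%N.
  by apply: leq_trans (leq_mul a19 nm) _; lia.
have mk : (272 * 272 * m <= m * (k * k))%N.
  by rewrite mulnC leq_mul2l leq_mul ?orbT.
move: an2 mk H; rewrite -!(ler_nat R).
have -> : (342 * (m * (k * k)))%:R = 342 * (m * (k * k))%:R :> R by rewrite natrM.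
have -> : (272 * 272 * m)%:R = 272 * 272 * m%:R :> R by rewrite !natrM.
have -> : (2 * p * (s + 2) + 4 * m)%:R = 2 * (p * (s + 2))%:R + 4 * m%:R :> R.
  by rewrite natrD !natrM; ring.
have := ler0n R (p * (s + 2)).
move: (m * (k * k))%:R => u; move: m%:R (p * (s + 2))%:R (alpha * n'.+1)%:R => v x y.
by move=> *; lra.
Qed.

Theorem theorem1p7 (R : realType) :
  exists (c : R) (n0 : nat), 0 < c /\
    forall n alpha p s : nat,
      (n0 <= n)%N -> (2 <= alpha <= n)%N -> (1 <= p)%N ->
    forall A : rand_streaming_alg R n s,
      solves A p alpha (@ham_path n) \/ solves A p alpha (@ham_cycle n) ->
      c * (alpha%:R * n%:R / (p%:R * ln (alpha%:R : R) ^+ 2)) <= s%:R.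
Proof.
pose a : R := 342 * (4 * 96 * 96).
have a_ge : 24 * (18 * 272) <= a by rewrite /a; lra.
have bound := @space_bound R; rewrite -/a in bound.
have a0 : 0 < a by apply: lt_le_trans a_ge; lra.
move: (24 * (18 * 272)) a a_ge a0 bound => d a a_ge a0 bound.
(* For [s > 0], [s + 2 <= 3 * s] costs [3 * a], and the additive constant [d <= a] the rest. *)
pose C := 4 * a; have C0 : 0 < C by rewrite mulr_gt0.
(* The bound [alpha * n <= C * p * s], without logarithms, is what gets proved; [ln 2 ^+ 2] is the
   least value of the squared logarithm of [alpha]. The 5 ensures [4 <= n']. *)
exists (ln 2 ^+ 2 / C), (Num.bound C + 5)%N.
have ln20 : 0 < ln (2 : R) by rewrite ln_gt0 // ltr1n.
split; first by rewrite divr_gt0 // exprn_gt0.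
move=> n alpha p s n0 an p1 A sol.
have [cyc {}sol] : exists cyc, solves A p alpha (@sol_of cyc n).
  by case: sol => sol; [exists false | exists true].
case: n n0 an A sol => [|n'] n0 an A sol; first by lia.
have n4 : (4 <= n')%N by lia.
have /andP[a2 _] := an.
have main : (alpha * n'.+1)%:R <= C * (p * s)%:R :> R.
  (* With [s = 0] one pass suffices, and [alpha * n <= 2 * a + d < C] contradicts the choice of the
     threshold for [n]. *)
  case: (posnP s) A sol => [-> A|s0 A] sol.
    have := bound _ _ _ _ _ _ (solves_one_pass p1 sol) n4 an.
    have : C < (alpha * n'.+1)%:R :> R.
      apply: lt_le_trans (archi_boundP (ltW C0)) _; rewrite ler_nat.
      by apply: leq_trans (leq_addr 5 _) _; apply: leq_trans n0 _; apply: leq_pmull; lia.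
    rewrite /C mul1n add0n; lra.
  apply: le_trans (bound _ _ _ _ _ _ sol n4 an) _; rewrite /C.
  have x3 : (p * (s + 2))%:R <= 3 * (p * s)%:R :> R.
    by rewrite -natrM ler_nat; nia.
  have z1 : 1 <= (p * s)%:R :> R by rewrite ler1n muln_gt0 p1.
  move: (p * (s + 2))%:R (p * s)%:R x3 z1 => x z x3 z1.
  have := ler_wpM2l (ltW a0) x3; have := ler_wpM2l (ltW a0) z1; lra.
have ale : ln 2 <= ln (alpha%:R : R) by rewrite ler_ln ?posrE ?ltr0n ?ler_nat // ltnW.
have l2 : ln (2 : R) ^+ 2 <= ln (alpha%:R : R) ^+ 2.
  by rewrite ler_pXn2r // nnegrE ltW // (lt_le_trans ln20 ale).
have p0 : 0 < p%:R :> R by rewrite ltr0n.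
have q0 : 0 < ln (alpha%:R : R) ^+ 2 by apply: lt_le_trans l2; rewrite exprn_gt0.
rewrite natrM [(p * s)%:R]natrM in main.
move: q0 l2 main; move: (ln 2 ^+ 2) (sqr_ge0 (ln (2 : R))) (ln alpha%:R ^+ 2) => u u0 v v0 uv.
move: (_ * n'.+1%:R) => y yC.
have -> : u / C * (y / (p%:R * v)) = u * y / (C * (p%:R * v)).
  by field; rewrite !gt_eqF.
rewrite ler_pdivrMr ?mulr_gt0 //; apply: le_trans (ler_wpM2l u0 yC) _.
have -> : s%:R * (C * (p%:R * v)) = v * (C * (p%:R * s%:R)) by ring.
by apply: ler_wpM2r uv; rewrite !mulr_ge0 ?ler0n // ltW.
Qed.
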